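(* Let $d\ge 1$, and consider a minimal faithful action of $\mathbb{Z}^d$ by homeomorphisms on a Cantor set that is conjugate to the shift action of $\mathbb{Z}^d$ on a closed $\mathbb{Z}^d$-invariant subset of $\mathsf{X}^{\mathbb{Z}^d}$ for some finite alphabet $\mathsf{X}$. Then the commutator subgroup of the topological full group $[[\mathbb{Z}^d]]$ of this action is finitely generated.
   Context: The shift action of $\mathbb{Z}^d$ on $\mathsf{X}^{\mathbb{Z}^d}$ (product topology, $\mathsf{X}$ discrete) is $g(w)(h)=w(h-g)$ for $g,h\in\mathbb{Z}^d$, $w\in\mathsf{X}^{\mathbb{Z}^d}$. An action is minimal if every orbit is dense. Two actions of $\mathbb{Z}^d$ are conjugate if there is an equivariant homeomorphism between the spaces. For an action of a group $G$ by homeomorphisms on a Cantor set, the topological full group $[[G]]$ is the group of all homeomorphisms of the Cantor set that are locally equal to the action of elements of $G$, i.e. every point has a neighborhood on which the homeomorphism coincides with the action of some element of $G$. *)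

(* Defs.v *)
From HB Require Import structures.
From mathcomp Require Import all_boot all_order all_algebra.
From mathcomp Require Import all_classical all_reals topology cantor.

Set Implicit Arguments.
Unset Strict Implicit.
Unset Printing Implicit Defensive.

Import Order.TTheory GRing.Theory Num.Theory.
Local Open Scope classical_set_scope.
Local Open Scope ring_scope.

Record homeo (S T : topologicalType) := Homeo {
  homeo_fun :> S -> T;
  homeo_inv : T -> S;
  homeo_continuous : continuous homeo_fun;
  homeo_inv_continuous : continuous homeo_inv;
  homeoK : cancel homeo_fun homeo_inv;
  homeoVK : cancel homeo_inv homeo_fun }.

Lemma homeo_ext (S T : topologicalType) (f g : homeo S T) : f =1 g -> f = g.
Proof.
case: f g => [f f' cf cf' fK f'K] [g g' cg cg' gK g'K] /= /funext fg.
case: _ / fg in cg gK g'K *.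
have f'g' : f' = g' by apply/funext => y; rewrite -{1}[y]g'K fK.
by case: _ / f'g' in cg' gK g'K *; congr Homeo; exact: Prop_irrelevance.
Qed.

Definition selfhomeo (T : topologicalType) : Type := homeo T T.

Section SelfHomeoGroup.
Context {T : topologicalType}.

HB.instance Definition _ := gen_eqMixin (selfhomeo T).
HB.instance Definition _ := gen_choiceMixin (selfhomeo T).

Definition homeo_one : selfhomeo T.
Proof. by refine (@Homeo T T idfun idfun _ _ _ _) => // x. Defined.

Definition homeo_opp (f : selfhomeo T) : selfhomeo T :=
  Homeo (@homeo_inv_continuous _ _ f) (@homeo_continuous _ _ f)
        (@homeoVK _ _ f) (@homeoK _ _ f).

Definition homeo_mul (f g : selfhomeo T) : selfhomeo T.
Proof.
refine (@Homeo T T (f \o g) (homeo_inv g \o homeo_inv f) _ _ _ _).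
- by move=> x; apply: continuous_comp; exact: homeo_continuous.
- by move=> x; apply: continuous_comp; exact: homeo_inv_continuous.
- by move=> x /=; rewrite !homeoK.
- by move=> x /=; rewrite !homeoVK.
Defined.

Lemma homeo_mulA : associative homeo_mul.
Proof. by move=> f g h; exact: homeo_ext. Qed.

Lemma homeo_mul1 : left_id homeo_one homeo_mul.
Proof. by move=> f; exact: homeo_ext. Qed.

Lemma homeo_mulr1 : right_id homeo_one homeo_mul.
Proof. by move=> f; exact: homeo_ext. Qed.

Lemma homeo_mulV : left_inverse homeo_one homeo_opp homeo_mul.
Proof. by move=> f; apply: homeo_ext => x /=; rewrite homeoK. Qed.

Lemma homeo_mulrV : right_inverse homeo_one homeo_opp homeo_mul.
Proof. by move=> f; apply: homeo_ext => x /=; rewrite homeoVK. Qed.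

HB.instance Definition _ := isGroup.Build (selfhomeo T)
  homeo_mulA homeo_mul1 homeo_mulr1 homeo_mulV homeo_mulrV.

End SelfHomeoGroup.

Section Subgroups.
Context {G : groupType}.
Implicit Types A H : set G.

Definition generated A : set G :=
  smallest [set H | group_closed [in H]] A.

Definition commutator_subgroup H : set G :=
  generated [set [~ f, g]%g | f in H & g in H].

Definition finitely_generated H :=
  exists2 A : set G, finite_set A & H = generated A.

End Subgroups.

Section Actions.
Context {V : zmodType} {T : topologicalType}.
Implicit Type a : V -> selfhomeo T.

Definition is_action a := forall g h, a (g + h) = (a g * a h)%g.

Definition faithful_action a := injective a.

Definition minimal_action a := forall x, dense [set a g x | g in [set: V]].

Definition full_group a : set (selfhomeo T) :=
  [set f | forall x : T, exists g, \forall y \near x, f y = a g y].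

End Actions.

Definition conjugate (V : zmodType) (S T : topologicalType)
    (a : V -> selfhomeo S) (b : V -> selfhomeo T) :=
  exists phi : homeo S T, forall g x, phi (a g x) = b g (phi x).

(* `cantor_like` is not used here, as it does not entail metrizability. *)
Definition cantor_set (T : topologicalType) := inhabited (homeo cantor_space T).

Lemma reindex_continuous (I : eqType) (Y : topologicalType) (s : I -> I) :
  continuous ((fun w i => w (s i)) : {ptws I -> Y} -> {ptws I -> Y}).
Proof.
move=> w.
apply/cvg_sup; first exact/fmap_filter/(nbhs_filter w).
move=> h U [_ /= [[A oA <-] /= Ah] AU].
apply: (filterS AU).
  exact/fmap_filter/(nbhs_filter w).
apply: (@proj_continuous I (fun=> Y) (s h) w A).
by apply: open_nbhs_nbhs; split.
Qed.

Section Shift.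
Context {V : zmodType} {Y : topologicalType}.

Local Notation configuration := {ptws V -> Y}.

Definition shift (g : V) (w : configuration) : configuration :=
  fun h => w (h - g).

Lemma shiftK g : cancel (shift g) (shift (- g)).
Proof. by move=> w; apply/funext => h; rewrite /shift opprK addrK. Qed.

Lemma shiftVK g : cancel (shift (- g)) (shift g).
Proof. by move=> w; apply/funext => h; rewrite /shift opprK subrK. Qed.

Lemma shift_continuous g : continuous (shift g).
Proof.
exact: (@reindex_continuous V Y (fun h => h - g)).
Qed.

Context (W : set configuration) (W_inv : forall g w, W w -> W (shift g w)).

Definition subshift_fun (g : V) (w : W) : W :=
  exist _ (shift g (val w)) (mem_set (W_inv g (set_mem (valP w)))).

Lemma subshift_funK g : cancel (subshift_fun g) (subshift_fun (- g)).
Proof. by move=> w; apply: val_inj; exact: shiftK. Qed.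

Lemma subshift_funVK g : cancel (subshift_fun (- g)) (subshift_fun g).
Proof. by move=> w; apply: val_inj; exact: shiftVK. Qed.

Lemma subshift_fun_continuous g : continuous (subshift_fun g).
Proof.
apply: continuous_comp_initial => w.
apply: (@continuous_comp W configuration configuration set_val (shift g)).
  exact: initial_continuous.
exact: shift_continuous.
Qed.

Definition subshift (g : V) : selfhomeo W :=
  Homeo (@subshift_fun_continuous g) (@subshift_fun_continuous (- g))
        (subshift_funK g) (subshift_funVK g).

End Shift.

Definition conjugate_to_subshift (V : zmodType) (T : topologicalType)
    (a : V -> selfhomeo T) :=
  exists (X : finType) (W : set {ptws V -> discrete_topology X})
         (W_inv : forall g w, W w -> W (shift g w)),
    closed W /\ conjugate a (subshift W_inv).

(* Main.v *)
Require Import Defs.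
From mathcomp Require Import all_boot all_order all_algebra.
From mathcomp Require Import all_classical all_reals topology cantor.
From mathcomp Require Import finmap zify.

(** Write [F] for the full group and [D] for its commutator subgroup.  A minimal
    faithful action of an abelian group is free, so an element of [F] is the
    same thing as a locally constant cocycle with values in the lattice
    ([full_groupP]).  Let [A] be the subgroup generated by the elements of order
    three of [F]; it is normal in [F].  The proof exhibits a subgroup [H],
    generated by finitely many three-cycles, and shows [D <= A <= H <= D].

    Any element of order three is a product of three-cycles [cycle3 U p q r],
    which permute cyclically the disjoint translates [p U], [q U], [r U] of a
    clopen set and can be taken with [U] as small as desired
    ([order3_generated]).

    [D <= A] ([commutator_order3]).  If [f] is in [F], choose a clopen set [W]
    disjoint from [f W] and maximal for that property up to the action of [f].
    The involution exchanging [W] and [f W] makes [f] trivial on [W], and at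
    most two thirds of the density of the support survive.  Iterating, [f] is a
    product of involutions and of an element whose support has small density in
    all large boxes; involutions are products of involutions with small support.
    So [F] is generated by elements with thin support.  Given two thin sets,
    the growth of boxes in the lattice being doubling, a first-fit construction
    yields a product of three-cycles moving the first set off itself and off the
    second ([displace_thin]).  Hence, modulo [A], two thin elements have
    representatives with disjoint supports, and [F / A] is abelian.

    [A <= H].  Two three-cycles with a single common position have a three-cycle
    as commutator, and that commutator lives on the intersection of the two
    clopen sets ([commutator_cycle3]).  Start from a finite clopen partition
    that is fine and whose translates separate points, which exists because the
    action is a subshift, and let [H] be generated by the three-cycles with
    short labels on the cells and on the intersections of cells with their
    neighbouring translates.  The sets on which all short three-cycles are in
    [H] form a Boolean algebra, by the commutator identity, and this algebra is
    invariant under translation ([good_shift]); so it contains all clopen sets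
    ([good_all]).  Long labels are reached through chains of short ones
    ([cycles_in_union]).

    [H <= D] is again the commutator identity ([cycle3_in_commutator]). *)

Set Implicit Arguments.
Unset Strict Implicit.
Unset Printing Implicit Defensive.

Import Order.TTheory GRing.Theory Num.Theory.
Local Open Scope classical_set_scope.
Local Open Scope ring_scope.

(** * Generated subgroups and commutators *)

Section Generation.
Context {G : groupType}.
Implicit Types (A H N F : set G) (f g h x y : G).
Local Open Scope group_scope.

Lemma group_closedE H : group_closed [in H] <->
  [/\ H 1, forall x y, H x -> H y -> H (x * y) & forall x, H x -> H x^-1].
Proof.
split=> [Hg | [H1 HM HV]].
  split=> [|x y Hx Hy|x Hx]; first by case: Hg => /set_mem.
    by apply: set_mem; apply: (group_closedM Hg); apply: mem_set.
  by apply: set_mem; apply: (group_closedV Hg); apply: mem_set.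
split; first exact: mem_set.
by move=> x y /set_mem Hx /set_mem Hy; apply: mem_set; apply/HM/HV.
Qed.

Lemma generated_group A : group_closed [in generated A].
Proof.
apply/group_closedE; split=> [|x y gx gy|x gx] H [/[dup] /group_closedE[H1 HM HV] Hg] AH //.
- by apply: HM; [apply: gx | apply: gy].
- by apply: HV; apply: gx.
Qed.

Lemma sub_generated A : A `<=` generated A.
Proof. exact: sub_gen_smallest. Qed.

Lemma generated_sub A H : group_closed [in H] -> A `<=` H -> generated A `<=` H.
Proof. exact: smallest_sub. Qed.

Lemma commg_mull x y z : [~ x * y, z] = [~ x, z] ^ y * [~ y, z].
Proof. by rewrite !commgEl !conjgE !invgM !mulgA !mulgK. Qed.

Lemma commgVl x y : [~ x^-1, y] = [~ x, y]^-1 ^ x^-1.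
Proof.
by rewrite !commgEl !conjgE !invgM !invgK !mulgA mulgK.
Qed.

(** If the generators commute modulo [N], the set of elements commuting modulo
    [N] with a given one is a subgroup, by the identities for commutators of
    products; applying this in each variable gives the claim. *)
Lemma commutator_generated F N A :
  group_closed [in F] -> group_closed [in N] ->
  (forall n f, N n -> F f -> N (n ^ f)) -> A `<=` F ->
  (forall x y, A x -> A y -> N [~ x, y]) ->
  forall x y, generated A x -> generated A y -> N [~ x, y].
Proof.
move=> Fg /[dup] /group_closedE[N1 NM NV] Ng NJ AF AN.
have [F1 FM FV] := (group_closedE F).1 Fg.
pose K y : set G := [set x | F x /\ N [~ x, y]].
have Kg y : group_closed [in K y].
  apply/group_closedE; split=> [|x1 x2 [F1' N1'] [F2' N2']|x [Fx Nx]].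
  - by split; rewrite // comm1g.
  - by split; [exact: FM | rewrite commg_mull; apply: NM => //; apply: NJ].
  - split; first exact: FV.
    by rewrite commgVl; apply: NJ; [exact: NV | exact: FV].
have AK y x : A y -> generated A x -> K y x.
  move=> Ay; move: x; apply: (generated_sub (Kg y)) => x Ax.
  by split; [exact: AF | exact: AN].
move=> x y gx; move: y; have [Fx _ ] : F x /\ True.
  by split=> //; move: x gx; exact: generated_sub.
suff KS : generated A `<=` K x by move=> y /KS[_ Ny]; rewrite -invgR; apply: NV.
apply: (generated_sub (Kg x)) => y Ay; split; first exact: AF.
by rewrite -invgR; apply: NV; case: (AK y x Ay gx).
Qed.

(** Modulo a normal subgroup containing [c], the element [h] equals its
    conjugate by [c]. *)
Lemma commutator_conjugate F N c h h' :
  group_closed [in F] -> group_closed [in N] ->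
  (forall n f, N n -> F f -> N (n ^ f)) ->
  F c -> F h -> F h' -> N c -> commute (h ^ c) h' -> N [~ h, h'].
Proof.
move=> /group_closedE[F1 FM FV] /group_closedE[N1 NM NV] NJ Fc Fh Fh' Nc chh'.
set u := [~ h, c].
have Nu : N u by rewrite /u commgEr; apply: NM => //; apply: NJ => //; exact: NV.
have -> : h = (h ^ c) * u^-1 by rewrite /u commgEl invgM invgK mulVKg.
rewrite commg_mull (eqP (introT commgP chh')) conj1g mul1g commgEl invgK.
by apply: NM => //; apply: NJ => //; apply: NV.
Qed.

End Generation.

(** * Locally constant functions *)

(** Clopen sets are encoded as locally constant boolean functions, so that
    Boolean operations and definitions by cases are plain expressions. *)
Definition loc_const (T : topologicalType) (X : Type) (u : T -> X) :=
  forall x, \forall y \near x, u y = u x.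

Section LocallyConstant.
Context {T : topologicalType}.

Lemma loc_const_cst X (c : X) : loc_const (fun _ : T => c).
Proof. by move=> x; apply: nearW. Qed.

Lemma loc_const_map X Y (F : X -> Y) (u : T -> X) :
  loc_const u -> loc_const (fun x => F (u x)).
Proof. by move=> uc x; apply: filterS (uc x) => y ->. Qed.

Lemma loc_const_map2 X Y Z (F : X -> Y -> Z) (u : T -> X) (v : T -> Y) :
  loc_const u -> loc_const v -> loc_const (fun x => F (u x) (v x)).
Proof. by move=> uc vc x; apply: filterS2 (uc x) (vc x) => y -> ->. Qed.

Lemma loc_const_if X (b : T -> bool) (u v : T -> X) :
  loc_const b -> loc_const u -> loc_const v ->
  loc_const (fun x => if b x then u x else v x).
Proof.
by move=> bc uc vc x; apply: filterS3 (bc x) (uc x) (vc x) => y -> -> ->.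
Qed.

Lemma loc_const_comp (S : topologicalType) X (f : S -> T) (u : T -> X) :
  continuous f -> loc_const u -> loc_const (fun x => u (f x)).
Proof. by move=> fc uc x; apply: fc (uc (f x)). Qed.

Lemma loc_const_seq (I : Type) X (s : seq I) (u : I -> T -> X) :
  (forall i, loc_const (u i)) -> loc_const (fun x => [seq u i x | i <- s]).
Proof.
move=> uc; elim: s => [|i s IH] /=; first exact: loc_const_cst.
exact: (loc_const_map2 cons (uc i) IH).
Qed.

Lemma loc_const_open (b : T -> bool) : loc_const b -> open [set x | b x].
Proof.
by move=> bc; rewrite openE => x /= bx; apply: filterS (bc x) => y /= ->.
Qed.

Lemma clopen_loc_const (A : set T) : clopen A -> loc_const (fun x => `[< A x >]).
Proof.
move=> [oA cA] x; case: (pselect (A x)) => Ax.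
  have : nbhs x A by apply: open_nbhs_nbhs.
  by apply: filterS => y Ay; rewrite !asboolT.
have : nbhs x (~` A) by apply: open_nbhs_nbhs; split=> //; exact: closed_openC.
by apply: filterS => y Ay; rewrite !asboolF.
Qed.

Context (compT : cover_compact [set: T]).

Lemma finite_cover (U : T -> T -> bool) :
  (forall x, loc_const (U x)) -> (forall x, U x x) ->
  exists s : seq T, forall y, has (U^~ y) s.
Proof.
move=> Uc Uxx; case: (compT (I := T) (D := setT) (f := fun x => [set y | U x y])).
- by move=> x _; exact: loc_const_open.
- by move=> x _; exists x => //=.
move=> D _ Dcov; exists (D : seq T) => y.
have [x xD Uxy] := Dcov y Logic.I.
by apply/hasP; exists x.
Qed.

Lemma loc_const_finite (X : eqType) (u : T -> X) :
  loc_const u -> exists s : seq X, forall x, u x \in s.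
Proof.
move=> uc; have [||s Ps] := @finite_cover (fun x y => u y == u x).
- by move=> x; apply: (loc_const_map (fun z => z == u x)) uc.
- by move=> x /=.
exists (map u s) => y; have /hasP[x xs /eqP ->] := Ps y.
exact: map_f.
Qed.

(** As in the Stone-Weierstrass theorem, compactness is used twice, for each of
    the two separated points in turn. *)
Lemma separating_algebra (B : (T -> bool) -> Prop) :
  (forall u, B u -> loc_const u) ->
  (forall u, B u -> B (fun x => ~~ u x)) ->
  (forall u v, B u -> B v -> B (fun x => u x && v x)) ->
  B (fun _ => true) ->
  (forall x y, x != y -> exists2 u, B u & u x && ~~ u y) ->
  forall u, loc_const u -> B u.
Proof.
move=> Bc BC BI BT Bsep u uc.
have BU v w : B v -> B w -> B (fun x => v x || w x).
  move=> Bv Bw; have := BC _ (BI _ _ (BC _ Bv) (BC _ Bw)).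
  by congr B; apply/funext => x; rewrite negb_and !negbK.
have BallT (s : seq T) (v : T -> T -> bool) : (forall x, B (v x)) ->
    B (fun x => all (v^~ x) s).
  by move=> Bv; elim: s => [|z s IH] //=; exact: BI.
have BhasT (s : seq T) (v : T -> T -> bool) : (forall x, B (v x)) ->
    B (fun x => has (v^~ x) s).
  move=> Bv; elim: s => [|z s IH] /=; last exact: BU.
  by have := BC _ BT.
have inner x : exists v, [/\ B v, u x -> v x & u x -> forall y, v y -> u y].
  case: (boolP (u x)) => ux; last by exists (fun _ => true).
  have /choice[w Pw] : forall y, exists w, [/\ B w, w x & ~~ w y || u y].
    move=> y; case: (boolP (u y)) => uy; first by exists (fun _ => true); rewrite orbT.
    have [|w Bw /andP[wx wy]] := Bsep x y; first by apply: contraNneq uy => <-.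
    by exists w; split; rewrite // wy.
  have [y||s Ps] := @finite_cover (fun y z => ~~ w y z || u z).
  - by apply: (loc_const_map2 (fun b c => ~~ b || c)) uc; apply: Bc; case: (Pw y).
  - by move=> y; case: (Pw y).
  exists (fun z => all (w^~ z) s); split.
  - by apply: BallT => y; case: (Pw y).
  - by move=> _; apply/allP => y _; case: (Pw y).
  - move=> _ z /= /allP wz; have /hasP[y ys] := Ps z.
    by rewrite (wz _ ys).
have [v Pv] := choice inner.
have [x|x|s Ps] := @finite_cover (fun x y => if u x then v x y else ~~ u y).
- case: (u x); first by apply: Bc; case: (Pv x).
  exact: (loc_const_map negb).
- by case: ifP => [ux|->//]; case: (Pv x) => _ ->.
suff -> : u = (fun y => has (v^~ y) [seq x <- s | u x]).
  by apply: BhasT => x; case: (Pv x).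
apply/funext => y; apply/idP/hasP => [uy | [x]]; last first.
  by rewrite mem_filter => /andP[ux _]; case: (Pv x) => _ _; apply.
have /hasP[x xs] := Ps y; case: ifP => [ux vxy|]; last by rewrite uy.
by exists x; rewrite // mem_filter ux.
Qed.

End LocallyConstant.

(** * Boxes in the lattice *)

Section Boxes.
Context {d : nat}.
Implicit Types (g h : 'rV[int]_d) (R : nat).

Definition box R : seq 'rV[int]_d :=
  [seq \row_j ((f j : nat)%:Z - R%:Z) | f : {ffun 'I_d -> 'I_(R.*2.+1)}].

Lemma mem_box R g : (g \in box R) = [forall j, `|g 0 j| <= R%:Z].
Proof.
apply/mapP/forallP => [[f _ ->] j | gR].
  by rewrite mxE; have := ltn_ord (f j); move: (nat_of_ord (f j)) => m; lia.
have lt j : (absz (g 0 j + R%:Z)%R < R.*2.+1)%N by have := gR j; lia.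
exists [ffun j => Ordinal (lt j)]; first by rewrite mem_enum.
by apply/rowP => j; rewrite mxE ffunE /=; have := gR j; lia.
Qed.

Lemma box_uniq R : uniq (box R).
Proof.
rewrite map_inj_uniq ?enum_uniq // => f1 f2 /rowP E; apply/ffunP => j.
by apply: val_inj => /=; have := E j; rewrite !mxE => /addIr[].
Qed.

Lemma size_box R : size (box R) = (R.*2.+1 ^ d)%N.
Proof. by rewrite size_map -cardE card_ffun !card_ord. Qed.

Lemma box0 R : 0 \in box R.
Proof. by rewrite mem_box; apply/forallP => j; rewrite mxE normr0. Qed.

Lemma boxN R g : (- g \in box R) = (g \in box R).
Proof. by rewrite !mem_box; apply: eq_forallb => j; rewrite mxE normrN. Qed.

Lemma boxD R S g h : g \in box R -> h \in box S -> g + h \in box (R + S).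
Proof.
rewrite !mem_box => /forallP gR /forallP hS; apply/forallP => j.
by rewrite mxE PoszD; apply: le_trans (ler_normD _ _) (lerD _ _).
Qed.

Lemma box_sub R S g h : g \in box R -> h \in box S -> g - h \in box (R + S).
Proof. by move=> gR hS; apply: boxD; rewrite ?boxN. Qed.

Lemma box_mono R S g : (R <= S)%N -> g \in box R -> g \in box S.
Proof.
move=> RS; rewrite !mem_box => /forallP gR; apply/forallP => j.
by have := gR j; lia.
Qed.

Lemma in_some_box g : exists R, g \in box R.
Proof.
exists (\sum_j absz (g 0%R j))%N; rewrite mem_box; apply/forallP => j.
by rewrite -abszE lez_nat (bigD1 j) //= leq_addr.
Qed.

Lemma sub_some_box (s : seq 'rV[int]_d) : exists R, {subset s <= box R}.
Proof.
elim: s => [|g s [R sR]]; first by exists 0%N.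
have [S gS] := in_some_box g; exists (R + S)%N => h; rewrite inE.
case/predU1P => [->|/sR]; [apply: box_mono gS | apply: box_mono]; lia.
Qed.

Lemma norm_sub_sg R (z : int) : `|z| <= R.+1%:Z -> `|z - Num.sg z| <= R%:Z.
Proof.
case: (ltrgt0P z) => [z0|z0|->]; last by rewrite sgr0 subr0 normr0.
  by rewrite gtr0_sg //; lia.
by rewrite ltr0_sg //; lia.
Qed.

(** Subtracting from a vector the signs of its coordinates lowers its sup norm. *)
Lemma box_ind (P : 'rV[int]_d -> Prop) :
  P 0 -> (forall g e, e \in box 1 -> P g -> P (g + e)) -> forall g, P g.
Proof.
move=> P0 Pe g; have [R] := in_some_box g; elim: R g => [|R IH] g.
  rewrite mem_box => /forallP g0; suff -> : g = 0 by [].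
  by apply/rowP => j; rewrite mxE; have := g0 j; lia.
move=> gR; pose e : 'rV[int]_d := \row_j Num.sg (g 0 j).
rewrite -(subrK e g); apply: Pe.
  by rewrite mem_box; apply/forallP => j; rewrite mxE; case: sgrP; lia.
apply: IH; move: gR; rewrite !mem_box => /forallP gR; apply/forallP => j.
by have := gR j; rewrite !mxE; exact: norm_sub_sg.
Qed.

Lemma leq_size_box3 R : (size (box (R * 3)) <= 3 ^ d * size (box R))%N.
Proof.
rewrite !size_box -expnMn; case: d => // n.
by rewrite leq_exp2r //; lia.
Qed.

Lemma ltn_size_box R : (0 < d)%N -> (R.*2 < size (box R))%N.
Proof.
by rewrite size_box; case: d => // n _; rewrite expnS leq_pmulr // expn_gt0.
Qed.

End Boxes.

(** * Full groups of free actions *)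

(** The Cantor set enters through compactness and the separation of points by
    clopen sets. *)
Record free_cantor_action (V : zmodType) (T : topologicalType)
    (a : V -> selfhomeo T) : Prop := FreeCantorAction {
  act_add : is_action a;
  act_free : forall g h x, a g x = a h x -> g = h;
  space_compact : cover_compact [set: T];
  space_separated : forall x y : T, x != y ->
    exists2 u : T -> bool, loc_const u & u x && ~~ u y }.

Section FullGroup.
Context {V : zmodType} {T : topologicalType} (a : V -> selfhomeo T).
Context (aP : free_cantor_action a).
Local Notation a_act := (act_add aP).
Local Notation a_free := (act_free aP).
Local Notation T_compact := (space_compact aP).
Local Notation T_sep := (space_separated aP).
Implicit Types (f : selfhomeo T) (x y : T) (g h : V) (U K : T -> bool).

Lemma homeo_mulE f f' x : (f * f')%g x = f (f' x).
Proof. by []. Qed.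

Lemma homeo_oneE x : (1%g : selfhomeo T) x = x.
Proof. by []. Qed.

Lemma homeo_VK f : cancel f (f^-1)%g.
Proof. by move=> x; rewrite -homeo_mulE mulVg. Qed.

Lemma homeo_KV f : cancel (f^-1)%g f.
Proof. by move=> x; rewrite -homeo_mulE mulgV. Qed.

Lemma homeo_inj f : injective f.
Proof. exact: can_inj (homeo_VK f). Qed.

Lemma actD g h x : a (g + h) x = a g (a h x).
Proof. by rewrite a_act. Qed.

Lemma act0 x : a 0 x = x.
Proof. by apply: (@homeo_inj (a 0)); rewrite -actD addr0. Qed.

Lemma actKN g x : a g (a (- g) x) = x.
Proof. by rewrite -actD subrr act0. Qed.

Lemma actNK g x : a (- g) (a g x) = x.
Proof. by rewrite -actD addNr act0. Qed.

Lemma act_eq g x : (a g x == x) = (g == 0).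
Proof.
apply/eqP/eqP => [|->]; last exact: act0.
by rewrite -{2}[x]act0 => /a_free.
Qed.

Definition move (phi : T -> V) x := a (phi x) x.

(** The cocycle is unique by freeness, hence agrees near each point with the
    constant given there by the definition of the full group. *)
Lemma full_groupP f :
  full_group a f <-> exists2 phi, loc_const phi & f =1 move phi.
Proof.
split=> [/choice[phi Hphi] | [phi phic fE] x]; last first.
  by exists (phi x); apply: filterS (phic x) => y <-; exact: fE.
have fE x : f x = a (phi x) x by exact: (nbhs_singleton (Hphi x)).
exists phi => // x; apply: filterS (Hphi x) => y; rewrite fE; exact: a_free.
Qed.

Lemma move_continuous phi : loc_const phi -> continuous (move phi).
Proof.
move=> phic x A; rewrite /move => nA.
have := @homeo_continuous _ _ (a (phi x)) x _ nA.
by apply: filterS2 (phic x) => y /= ->.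
Qed.

Lemma full_group_make phi psi : loc_const phi -> loc_const psi ->
  cancel (move phi) (move psi) -> cancel (move psi) (move phi) ->
  exists2 f, full_group a f & f =1 move phi.
Proof.
move=> phic psic c1 c2.
exists (Homeo (move_continuous phic) (move_continuous psic) c1 c2) => //.
by apply/full_groupP; exists phi.
Qed.

Lemma full_group_group : group_closed [in full_group a].
Proof.
apply/group_closedE; split.
- apply/full_groupP; exists (fun=> 0); first exact: loc_const_cst.
  by move=> x; rewrite /move act0.
- move=> f f' /full_groupP[phi pc fE] /full_groupP[psi sc f'E].
  apply/full_groupP; exists (fun x => phi (f' x) + psi x).
    by apply: (loc_const_map2 +%R) sc; apply: loc_const_comp pc; exact: homeo_continuous.
  by move=> x; rewrite homeo_mulE /move actD fE f'E.
- move=> f /full_groupP[phi pc fE].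
  apply/full_groupP; exists (fun x => - phi (f^-1%g x)).
    by apply: (loc_const_map -%R); apply: loc_const_comp pc; exact: homeo_continuous.
  by move=> x; rewrite /move -{3}[x](homeo_KV f) fE /move actNK.
Qed.

Lemma full_groupM f f' : full_group a f -> full_group a f' -> full_group a (f * f')%g.
Proof. by case/group_closedE: full_group_group => _ + _; apply. Qed.

Lemma full_groupV f : full_group a f -> full_group a (f^-1)%g.
Proof. by case/group_closedE: full_group_group => _ _; apply. Qed.

Lemma moved_loc_const f : full_group a f -> loc_const (fun x => f x != x).
Proof.
move=> /full_groupP[phi pc fE].
have -> : (fun x => f x != x) = (fun x => phi x != 0).
  by apply/funext => x; rewrite fE /move act_eq.
exact: (loc_const_map (fun g => g != 0)).
Qed.

Lemma loc_const_homeo X (u : T -> X) f : loc_const u -> loc_const (fun x => u (f x)).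
Proof. by apply: loc_const_comp; exact: homeo_continuous. Qed.

Lemma full_group_bounded f : full_group a f ->
  exists s : seq V, forall x, exists2 g, g \in s & f x = a g x.
Proof.
move=> /full_groupP[phi pc fE]; have [s Ps] := loc_const_finite T_compact pc.
by exists s => x; exists (phi x).
Qed.

Lemma full_group_restrict f K : full_group a f -> loc_const K ->
  (forall x, K (f x) = K x) ->
  exists2 f', full_group a f' & forall x, f' x = if K x then f x else x.
Proof.
move=> /[dup] /full_groupV/full_groupP[psi sc fVE] /full_groupP[phi pc fE] Kc Kf.
have KfV x : K (f^-1%g x) = K x by rewrite -Kf homeo_KV.
pose phiK x := if K x then phi x else 0; pose psiK x := if K x then psi x else 0.
have phiKE x : move phiK x = if K x then f x else x.
  by rewrite /move /phiK fE; case: ifP; rewrite ?act0.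
have psiKE x : move psiK x = if K x then f^-1%g x else x.
  by rewrite /move /psiK fVE; case: ifP; rewrite ?act0.
have [||||f' Ff' f'E] := @full_group_make phiK psiK.
- exact: loc_const_if (loc_const_cst _).
- exact: loc_const_if (loc_const_cst _).
- by move=> x; rewrite phiKE psiKE; case: (boolP (K x)) => [Kx|/negPf Kx]; rewrite ?Kf Kx ?homeo_VK.
- by move=> x; rewrite psiKE phiKE; case: (boolP (K x)) => [Kx|/negPf Kx]; rewrite ?KfV Kx ?homeo_KV.
by exists f' => // x; rewrite f'E phiKE.
Qed.

(** By compactness and disjointification, an element that has small invariant
    clopen sets around each point is a product of restrictions to such sets. *)
Lemma full_group_fragment (H : set (selfhomeo T)) f :
  group_closed [in H] -> full_group a f ->
  (forall x, exists K, [/\ loc_const K, K x, forall y, K (f y) = K y &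
    forall K' f', loc_const K' -> (forall y, K' (f y) = K' y) ->
      (forall y, K' y -> K y) -> full_group a f' ->
      (forall y, f' y = if K' y then f y else y) -> H f']) ->
  H f.
Proof.
move=> /group_closedE[H1 HM HV] Ff /choice[K PK].
have [x|x|s Ps] := finite_cover T_compact (U := K); try by case: (PK x).
suff W (K0 : T -> bool) f0 : loc_const K0 -> (forall y, K0 (f y) = K0 y) ->
    (forall y, K0 y -> has (K^~ y) s) -> (forall y, f0 y = if K0 y then f y else y) -> H f0.
  by apply: (W (fun=> true)) => //; exact: loc_const_cst.
elim: s K0 f0 {Ps} => [|z s IH] K0 f0 K0c K0f K0s f0E.
  suff -> : f0 = 1%g by [].
  by apply: homeo_ext => y; rewrite f0E; case: ifP => // /K0s.
have [Kc _ Kf KH] := PK z.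
have [||f1 F1 f1E] := @full_group_restrict f (fun y => K0 y && K z y) Ff.
- exact: (loc_const_map2 andb).
- by move=> y; rewrite K0f Kf.
have [||f2 F2 f2E] := @full_group_restrict f (fun y => K0 y && ~~ K z y) Ff.
- exact: (loc_const_map2 (fun b c => b && ~~ c)).
- by move=> y; rewrite K0f Kf.
have -> : f0 = (f1 * f2)%g.
  apply: homeo_ext => y; rewrite homeo_mulE f2E f0E f1E.
  case: (boolP (K0 y)) => /= [K0y|/negPf nK0]; last by rewrite nK0.
  by case: (boolP (K z y)) => Kz /=; rewrite ?K0f ?Kf ?K0y ?Kz ?(negPf Kz).
apply: HM.
- apply: (KH (fun y => K0 y && K z y)) => //.
  + exact: (loc_const_map2 andb).
  + by move=> y; rewrite K0f Kf.
  + by move=> y /andP[].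
- apply: (IH (fun y => K0 y && ~~ K z y)) => //.
  + exact: (loc_const_map2 (fun b c => b && ~~ c)).
  + by move=> y; rewrite K0f Kf.
  + by move=> y /andP[/K0s /= /orP[->//|]].
Qed.

(** ** Three-cycles of translates of a clopen set *)

Definition apart (s : seq V) U :=
  forall g, g \in s -> g != 0 -> forall x, U x -> ~~ U (a g x).

Definition diffs (L : seq V) : seq V := [seq p - q | p <- L, q <- L].

Lemma mem_diffs L p q : p \in L -> q \in L -> p - q \in diffs L.
Proof. exact: allpairs_f. Qed.

Lemma apart_sub (s s' : seq V) (U U' : T -> bool) : {subset s <= s'} ->
  (forall x, U x -> U' x) -> apart s' U' -> apart s U.
Proof.
move=> ss' UU' aU g gs g0 x Ux; apply/negP => /UU'; apply/negP.
by apply: aU => //; [exact: ss' | exact: UU'].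
Qed.

Lemma apart_nbhd (s : seq V) x : exists U, [/\ loc_const U, U x & apart s U].
Proof.
elim: s => [|g s [U [Uc Ux aU]]].
  by exists (fun=> true); split=> //; exact: loc_const_cst.
have [g0|g0] := eqVneq g 0.
  exists U; split=> // h; rewrite inE => /predU1P[->|]; last exact: aU.
  by rewrite g0 eqxx.
have [|u uc /andP[ux ugx]] := T_sep (x := x) (y := a g x).
  by rewrite eq_sym act_eq.
exists (fun y => U y && (u y && ~~ u (a g y))); split.
- apply: (loc_const_map2 andb) => //; apply: (loc_const_map2 (fun b c => b && ~~ c)) => //.
  exact: loc_const_homeo.
- by rewrite Ux ux.
- move=> h; rewrite inE => /predU1P[->|hs] h0 y /and3P[Uy uy ugy].
    by rewrite (negPf ugy) andbF.
  by rewrite (negPf (aU h hs h0 y Uy)).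
Qed.

Definition cycle_cocycle U p q r x : V :=
  if U (a (- p) x) then q - p else if U (a (- q) x) then r - q
  else if U (a (- r) x) then p - r else 0.

(** The permutation cycling [p U], [q U] and [r U].  Being total in [U] and in
    the labels, it is the identity when no homeomorphism is given by the
    cocycle, as may happen when these sets are not disjoint. *)
Definition cycle3 U p q r : selfhomeo T :=
  xget 1%g [set f : selfhomeo T | f =1 move (cycle_cocycle U p q r)].

(** The action of a three-cycle on labels: for [y] in [U], the cycle sends [l y]
    to [cycle_label p q r l y]. *)
Definition cycle_label p q r l : V :=
  if l == p then q else if l == q then r else if l == r then p else l.

Lemma cycle_cocycle_loc_const U p q r :
  loc_const U -> loc_const (cycle_cocycle U p q r).
Proof.
move=> Uc; have Ugc g := loc_const_homeo (a g) Uc.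
by do ![apply: loc_const_if => //]; exact: loc_const_cst.
Qed.

Lemma apart_label (L : seq V) U l p x : apart (diffs L) U -> l \in L -> p \in L ->
  U x -> U (a (- p) (a l x)) = (l == p).
Proof.
move=> aU lL pL Ux; rewrite -actD addrC; case: (eqVneq l p) => [->|lp].
  by rewrite subrr act0.
by apply/negbTE; apply: aU => //; [exact: mem_diffs | rewrite subr_eq0].
Qed.

Lemma move_cycle (L : seq V) (Q U : T -> bool) p q r l x :
  apart (diffs L) Q -> (forall y, U y -> Q y) -> {subset [:: p; q; r] <= L} ->
  l \in L -> Q x ->
  move (cycle_cocycle U p q r) (a l x) =
  a (if U x then cycle_label p q r l else l) x.
Proof.
move=> aQ UQ sL lL Qx.
have UE m : m \in L -> U (a (- m) (a l x)) = (l == m) && U x.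
  move=> mL; have [->|lm] /= := eqVneq l m; first by rewrite actNK.
  by apply/negP => /UQ; rewrite (apart_label aQ) // (negPf lm).
rewrite /move /cycle_cocycle /cycle_label !UE; try by apply: sL; rewrite !inE eqxx ?orbT.
case: (U x); last by rewrite !andbF act0.
by rewrite !andbT; do ![case: eqP => [->|_]]; rewrite -?actD ?subrK ?add0r.
Qed.

Lemma move_cycle_off U p q r x :
  ~~ U (a (- p) x) -> ~~ U (a (- q) x) -> ~~ U (a (- r) x) ->
  move (cycle_cocycle U p q r) x = x.
Proof.
by move=> Up Uq Ur; rewrite /move /cycle_cocycle (negPf Up) (negPf Uq) (negPf Ur) act0.
Qed.

Lemma labelP (L : seq V) U x :
  (exists l y, [/\ l \in L, U y & x = a l y]) \/
  (forall l, l \in L -> ~~ U (a (- l) x)).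
Proof.
case: (boolP (has (fun l => U (a (- l) x)) L)) => [/hasP[l lL Ul] | /hasPn]; last by right.
by left; exists l, (a (- l) x); rewrite actKN.
Qed.

Lemma cycle_label_in p q r l : l \in [:: p; q; r] -> cycle_label p q r l \in [:: p; q; r].
Proof.
by rewrite /cycle_label; do ![case: ifP => _]; rewrite ?inE ?eqxx ?orbT.
Qed.

Lemma cycle_labelK p q r : uniq [:: p; q; r] ->
  cancel (cycle_label p q r) (cycle_label p r q).
Proof.
rewrite /= !inE negb_or andbT => /andP[/andP[pq pr] qr] l; rewrite /cycle_label.
have [->|lp] := eqVneq l p; first by rewrite (eq_sym q) (negPf pq) (negPf qr) eqxx.
have [->|lq] := eqVneq l q; first by rewrite (eq_sym r) (negPf pr) eqxx.
have [->|lr] := eqVneq l r; first by rewrite eqxx.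
by rewrite (negPf lp) (negPf lq) (negPf lr).
Qed.

Lemma move_cycleK U p q r : uniq [:: p; q; r] -> apart (diffs [:: p; q; r]) U ->
  cancel (move (cycle_cocycle U p q r)) (move (cycle_cocycle U p r q)).
Proof.
move=> pqr aU x; have sub : {subset [:: p; r; q] <= [:: p; q; r]}.
  by move=> l; rewrite !inE; case/or3P => ->; rewrite ?orbT.
case: (labelP [:: p; q; r] U x) => [[l [y [lL Uy ->]]] | off].
  rewrite !(move_cycle aU) ?Uy ?cycle_labelK //; exact: cycle_label_in.
by rewrite !move_cycle_off ?off ?inE ?eqxx ?orbT.
Qed.

Lemma cycle3_spec U p q r : loc_const U -> uniq [:: p; q; r] ->
  apart (diffs [:: p; q; r]) U ->
  full_group a (cycle3 U p q r) /\ cycle3 U p q r =1 move (cycle_cocycle U p q r).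
Proof.
move=> Uc pqr aU.
have perm : perm_eq [:: p; r; q] [:: p; q; r] by rewrite perm_cons (perm_catC [:: r] [:: q]).
have [||||f Ff fE] := @full_group_make (cycle_cocycle U p q r) (cycle_cocycle U p r q).
- exact: cycle_cocycle_loc_const.
- exact: cycle_cocycle_loc_const.
- exact: move_cycleK.
- apply: move_cycleK; first by rewrite (perm_uniq perm).
  apply: apart_sub aU => // l /allpairsP[[m n] [/= mL nL ->]].
  by apply: mem_diffs; rewrite -(perm_mem perm).
have cE : cycle3 U p q r =1 move (cycle_cocycle U p q r).
  by rewrite /cycle3; case: xgetP => [g _ //|/(_ f)].
split=> //; suff -> : cycle3 U p q r = f by [].
by apply: homeo_ext => x; rewrite cE fE.
Qed.

Lemma cycle3E (L : seq V) (Q U : T -> bool) p q r l x :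
  loc_const U -> uniq [:: p; q; r] ->
  apart (diffs L) Q -> (forall y, U y -> Q y) -> {subset [:: p; q; r] <= L} ->
  l \in L -> Q x ->
  cycle3 U p q r (a l x) = a (if U x then cycle_label p q r l else l) x.
Proof.
move=> Uc pqr aQ UQ sL lL Qx; rewrite -(move_cycle aQ) //.
apply: (cycle3_spec _ _ _).2 => //.
apply: apart_sub aQ => // _ /allpairsP[[m n] [/= mL nL ->]].
by apply: mem_diffs; apply: sL.
Qed.

Lemma cycle3_off U p q r x : loc_const U -> uniq [:: p; q; r] ->
  apart (diffs [:: p; q; r]) U ->
  ~~ U (a (- p) x) -> ~~ U (a (- q) x) -> ~~ U (a (- r) x) ->
  cycle3 U p q r x = x.
Proof.
by move=> Uc pqr aU Up Uq Ur; rewrite (cycle3_spec Uc pqr aU).2 move_cycle_off.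
Qed.

(** In the symmetric group, the commutator of two three-cycles sharing exactly
    one point is again a three-cycle. *)
Lemma cycle_label_commutator p q q' r r' l : uniq [:: p; q'; q; r'; r] ->
  cycle_label p q' q (cycle_label p r' r l) =
  cycle_label p r' r (cycle_label p q' q (cycle_label p q r l)).
Proof.
move=> u5; pose e := [:: p; q'; q; r'; r].
case: (boolP (l \in e)) => [le|]; last first.
  rewrite !inE !negb_or => /and5P[lp lq' lq lr' lr].
  have fixl m n : l != m -> l != n -> cycle_label p m n l = l.
    by move=> lm ln; rewrite /cycle_label (negPf lp) (negPf lm) (negPf ln).
  by rewrite !fixl.
have E i j k n : (i < 5)%N -> (j < 5)%N -> (k < 5)%N -> (n < 5)%N ->
    cycle_label e`_i e`_j e`_k e`_n = e`_(if n == i then j else if n == j then k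
                                          else if n == k then i else n).
  by move=> *; rewrite /cycle_label !nth_uniq //; do ![case: ifP].
have [n n5 ->] : exists2 n, (n < 5)%N & l = e`_n.
  by exists (index l e); rewrite ?nth_index // -[5%N]/(size e) index_mem.
rewrite -[p]/(e`_0) -[q']/(e`_1) -[q]/(e`_2) -[r']/(e`_3) -[r]/(e`_4).
by do 5?[case: n n5 => [|n] n5; first by rewrite !E].
Qed.

Lemma cycle_label_closed (L : seq V) p q r l b : {subset [:: p; q; r] <= L} ->
  l \in L -> (if b then cycle_label p q r l else l) \in L.
Proof.
move=> sL lL; case: b => //; rewrite /cycle_label.
by do ![case: ifP => _]; rewrite // sL // !inE eqxx ?orbT.
Qed.

Lemma apart_translate (L : seq V) (Q U : T -> bool) M : {subset M <= L} ->
  (forall x, U x -> Q x) -> apart (diffs L) Q -> apart (diffs M) U.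
Proof.
move=> ML UQ aQ; apply: (apart_sub _ UQ aQ) => _ /allpairsP[[m n] [/= mM nM ->]].
by apply: mem_diffs; apply: ML.
Qed.

(** The commutator only sees the points where both cycles act: this is how
    three-cycles on intersections are obtained. *)
Lemma commutator_cycle3 (Q U W : T -> bool) p q q' r r' :
  loc_const U -> loc_const W -> (forall x, U x -> Q x) -> (forall x, W x -> Q x) ->
  uniq [:: p; q'; q; r'; r] -> apart (diffs [:: p; q'; q; r'; r]) Q ->
  [~ cycle3 U p q' q, cycle3 W p r' r]%g = cycle3 (fun x => U x && W x) p q r.
Proof.
move=> Uc Wc UQ WQ u5 aQ; set L := [:: _; _; _; _; _] in u5 aQ.
have Ic : loc_const (fun x => U x && W x) by exact: (loc_const_map2 andb).
have IQ x : U x && W x -> Q x by case/andP => /UQ.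
have sub1 : {subset [:: p; q'; q] <= L}.
  by move=> l; rewrite !inE => /or3P[] ->; rewrite ?orbT.
have sub2 : {subset [:: p; r'; r] <= L}.
  by move=> l; rewrite !inE => /or3P[] ->; rewrite ?orbT.
have sub3 : {subset [:: p; q; r] <= L}.
  by move=> l; rewrite !inE => /or3P[] ->; rewrite ?orbT.
have u_mask m : uniq (mask m L) by exact: (subseq_uniq (mask_subseq m L)).
have u1 : uniq [:: p; q'; q] by exact: (u_mask [:: true; true; true]).
have u2 : uniq [:: p; r'; r] by exact: (u_mask [:: true; false; false; true; true]).
have u3 : uniq [:: p; q; r] by exact: (u_mask [:: true; false; true; false; true]).
apply: (@mulgI _ (cycle3 W p r' r * cycle3 U p q' q)%g); rewrite -commgC.
apply: homeo_ext => x; rewrite !homeo_mulE.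
case: (labelP L Q x) => [[l [y [lL Qy ->]]] | off].
  rewrite !(cycle3E (L := L) (Q := Q)) //; try by do ?apply: cycle_label_closed.
  by case: (U y); case: (W y) => //=; rewrite cycle_label_commutator.
have fixx (A : T -> bool) m n k : loc_const A -> (forall z, A z -> Q z) ->
    uniq [:: m; n; k] -> {subset [:: m; n; k] <= L} -> cycle3 A m n k x = x.
  move=> Ac AQ mnk sub; apply: cycle3_off => //.
  - exact: apart_translate aQ.
  - by apply/negP => /AQ; apply/negP/off/sub; rewrite !inE eqxx.
  - by apply/negP => /AQ; apply/negP/off/sub; rewrite !inE eqxx ?orbT.
  - by apply/negP => /AQ; apply/negP/off/sub; rewrite !inE eqxx ?orbT.
by rewrite !fixx.
Qed.

Lemma cycle3_rot U p q r : loc_const U -> uniq [:: p; q; r] ->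
  apart (diffs [:: p; q; r]) U -> cycle3 U p q r = cycle3 U q r p.
Proof.
move=> Uc u3 aU; set L := [:: p; q; r] in u3 aU.
have u3' : uniq [:: q; r; p] by rewrite -(rot_uniq 2).
have sub : {subset [:: q; r; p] <= L}.
  by move=> l; rewrite !inE; case/or3P => ->; rewrite ?orbT.
apply: homeo_ext => x; case: (labelP L U x) => [[l [y [lL Uy ->]]] | off].
  rewrite !(cycle3E (L := L) (Q := U)) // Uy /cycle_label; congr (a _ y).
  move: u3; rewrite /= !inE negb_or andbT => /andP[/andP[pq pr] qr].
  by case: (eqVneq l p) => [->|] //; rewrite (negPf pq) (negPf pr).
rewrite !cycle3_off ?off ?inE ?eqxx ?orbT //.
exact: apart_translate aU.
Qed.

Lemma cycle3_split U K p q r : loc_const U -> loc_const K -> uniq [:: p; q; r] ->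
  apart (diffs [:: p; q; r]) U ->
  cycle3 U p q r =
  (cycle3 (fun x => U x && K x) p q r * cycle3 (fun x => U x && ~~ K x) p q r)%g.
Proof.
move=> Uc Kc u3 aU; set L := [:: p; q; r] in u3 aU.
have UKc : loc_const (fun x => U x && K x) by exact: (loc_const_map2 andb).
have UNc : loc_const (fun x => U x && ~~ K x).
  exact: (loc_const_map2 (fun b c => b && ~~ c)).
have UKU x : U x && K x -> U x by case/andP.
have UNU x : U x && ~~ K x -> U x by case/andP.
apply: homeo_ext => x; rewrite homeo_mulE.
case: (labelP L U x) => [[l [y [lL Uy ->]]] | off].
  rewrite !(cycle3E (L := L) (Q := U)) ?Uy //=; last exact: cycle_label_closed.
  by case: (K y).
have fixx (A : T -> bool) : loc_const A -> (forall z, A z -> U z) -> cycle3 A p q r x = x.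
  move=> Ac AU; apply: cycle3_off => //; first exact: apart_sub aU.
  - by apply/negP => /AU; apply/negP/off; rewrite !inE eqxx.
  - by apply/negP => /AU; apply/negP/off; rewrite !inE eqxx ?orbT.
  - by apply/negP => /AU; apply/negP/off; rewrite !inE eqxx ?orbT.
by rewrite !fixx.
Qed.

Lemma cycle3_translate U p q r e :
  cycle3 (fun x => U (a (- e) x)) p q r = cycle3 U (p + e) (q + e) (r + e).
Proof.
rewrite /cycle3; suff -> : cycle_cocycle (fun x => U (a (- e) x)) p q r =
  cycle_cocycle U (p + e) (q + e) (r + e) by [].
have diffE m n : (m + e) - (n + e) = m - n by rewrite opprD addrACA subrr addr0.
have transE m x : a (- (m + e)) x = a (- e) (a (- m) x) by rewrite -actD opprD addrC.
by apply/funext => x; rewrite /cycle_cocycle !diffE !transE.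
Qed.

Lemma cycle3_empty p q r : cycle3 (fun=> false) p q r = 1%g.
Proof.
rewrite /cycle3; case: xgetP => [f _ fE|] //; apply: homeo_ext => x.
by rewrite fE /move /cycle_cocycle act0.
Qed.

Lemma cycle3_partition (H : set (selfhomeo T)) (X : eqType) (k : T -> X) U p q r :
  group_closed [in H] -> loc_const U -> loc_const k -> uniq [:: p; q; r] ->
  apart (diffs [:: p; q; r]) U ->
  (forall v, H (cycle3 (fun x => U x && (k x == v)) p q r)) -> H (cycle3 U p q r).
Proof.
move=> /group_closedE[H1 HM HV] Uc kc u3 aU HU.
have [s Ps] := loc_const_finite T_compact kc.
suff W (W : T -> bool) : loc_const W -> (forall v, H (cycle3 (fun x => W x && (k x == v)) p q r)) ->
   (forall x, W x -> k x \in s) -> (forall x, W x -> U x) -> H (cycle3 W p q r).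
  exact: W.
elim: s W {Ps} => [|v s IH] W Wc HW Ws WU.
  suff -> : W = fun=> false by rewrite cycle3_empty.
  by apply/funext => x; apply/negP => /Ws.
have kvc : loc_const (fun x => k x == v) by exact: (loc_const_map (fun w => w == v)).
rewrite (cycle3_split Wc kvc u3); last exact: apart_sub aU.
apply: HM => //; apply: IH.
- exact: (loc_const_map2 (fun b c => b && ~~ c)).
- move=> w; have [->|wv] := eqVneq w v.
    rewrite (_ : (fun x => _) = fun=> false) ?cycle3_empty //.
    by apply/funext => x; rewrite -andbA andNb andbF.
  rewrite (_ : (fun x => _) = fun x => W x && (k x == w)) //.
  apply/funext => x; rewrite -andbA; congr andb.
  by case: (eqVneq (k x) w) => [->|]; rewrite ?wv // andbF.
- by move=> x /andP[/Ws]; rewrite inE => /predU1P[->|//]; rewrite eqxx.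
- by move=> x /andP[/WU].
Qed.

(** ** Elements of order two and three *)

(** An element of order three cycles the points of each of its orbits by three
    group elements that are constant near the orbit. *)
Lemma order3_generated (H : set (selfhomeo T)) f :
  group_closed [in H] ->
  (forall g h, uniq [:: 0; g; h] ->
    exists s : seq V, forall U, loc_const U -> apart s U -> H (cycle3 U 0 g h)) ->
  full_group a f -> (forall x, f (f (f x)) = x) -> H f.
Proof.
move=> Hg Hcyc Ff f3; have [phi phic fE] := (full_groupP f).1 Ff.
have [H1 _ _] := (group_closedE H).1 Hg.
apply: (full_group_fragment Hg Ff) => x.
have [fx|fx] := eqVneq (f x) x.
  exists (fun y => ~~ (f y != y)); split=> //.
  - exact: (loc_const_map negb (moved_loc_const Ff)).
  - by rewrite fx eqxx.
  - by move=> y; rewrite (inj_eq (@homeo_inj f)).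
  - move=> K f' Kc Kf Kfix _ f'E; suff -> : f' = 1%g by [].
    by apply: homeo_ext => y; rewrite f'E; case: ifP => // /Kfix /negPn/eqP.
pose g := phi x; pose h := phi (f x) + phi x.
have ga : f x = a g x := fE x.
have ha : f (f x) = a h x by rewrite actD -ga; exact: fE.
have u3 : uniq [:: 0; g; h].
  rewrite /= !inE negb_or andbT; apply/andP; split; first (apply/andP; split).
  - by apply: contra_neq fx; rewrite ga => <-; rewrite act0.
  - by apply: contra_neq fx => h0; rewrite -[RHS]f3 ha -h0 act0.
  - by apply: contra_neq fx => gh; apply: (@homeo_inj f); rewrite ha -gh -ga.
have [s Hs] := Hcyc g h u3; set L := [:: 0; g; h] in u3.
have [U0 [U0c U0x aU0]] := apart_nbhd (s ++ diffs L) x.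
pose U y := U0 y && ((phi y == g) && (phi (f y) == h - g)).
have Uc : loc_const U.
  apply: (loc_const_map2 andb) => //; apply: (loc_const_map2 andb).
    exact: (loc_const_map (fun v => v == g)).
  by apply: (loc_const_map (fun v => v == h - g)); exact: loc_const_homeo.
have UU0 y : U y -> U0 y by case/andP.
have Ug y : U y -> f y = a g y by case/and3P => _ /eqP phig _; rewrite fE /move phig.
have Uh y : U y -> f (a g y) = a h y.
  by move=> Uy; rewrite -Ug // fE /move; case/and3P: Uy => _ /eqP phig /eqP ->;
     rewrite fE /move phig -actD subrK.
have U1 y : U y -> f (a h y) = y by move=> Uy; rewrite -Uh // -Ug.
have Ux : U x by rewrite /U U0x eqxx /h addrK eqxx.
exists (fun y => [|| U y, U (f y) | U (f (f y))]); split.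
- apply: (loc_const_map2 orb) => //; apply: (loc_const_map2 orb);
    do ?exact: loc_const_homeo.
  by apply: (loc_const_homeo (u := fun y => U (f y))); exact: loc_const_homeo.
- by rewrite Ux.
- by move=> y; rewrite f3 orbA orbC.
move=> K f' Kc Kf KU _ f'E.
have KUc : loc_const (fun y => K y && U y) by exact: (loc_const_map2 andb).
have KUU y : K y && U y -> U y by case/andP.
have aU : apart (s ++ diffs L) U by exact: apart_sub aU0.
have aUL : apart (diffs L) U.
  by apply: apart_sub aU => // v vL; rewrite mem_cat vL orbT.
suff -> : f' = cycle3 (fun y => K y && U y) 0 g h.
  by apply: Hs => //; apply: apart_sub aU => // v vs; rewrite mem_cat vs.
apply: homeo_ext => y; rewrite f'E.
case: (labelP L U y) => [[l [z [lL Uz ->]]] | off].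
  rewrite (cycle3E (L := L) (Q := U)) // Uz andbT /cycle_label.
  have Kg : K (a g z) = K z by rewrite -Ug // Kf.
  have Kh : K (a h z) = K z by rewrite -Uh // Kf.
  move: u3; rewrite /= !inE negb_or andbT => /andP[/andP[g0 h0] gh].
  move: lL; rewrite !inE => /or3P[] /eqP ->.
  - by rewrite eqxx act0; case: (K z); rewrite ?act0 ?Ug.
  - by rewrite eqxx (eq_sym g) (negPf g0) Kg; case: (K z); rewrite ?Uh.
  - rewrite eqxx (eq_sym h 0) (eq_sym h g) (negPf h0) (negPf gh) Kh.
    by case: (K z); rewrite ?U1 ?act0.
rewrite cycle3_off //.
- case: ifP => // /KU /or3P[Uy|Uy|Uy].
  + by have := off 0; rewrite oppr0 act0 Uy inE eqxx => /(_ isT).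
  + have := off h; rewrite !inE eqxx !orbT => /(_ isT).
    by rewrite -{1}[y]f3 (Ug (f y)) // Uh // actNK Uy.
  + have := off g; rewrite !inE eqxx !orbT => /(_ isT).
    by rewrite -{1}[y]f3 (Ug (f (f y))) // actNK Uy.
- exact: apart_sub aUL.
- by apply/negP => /andP[_]; apply/negP/off; rewrite !inE eqxx.
- by apply/negP => /andP[_]; apply/negP/off; rewrite !inE eqxx ?orbT.
- by apply/negP => /andP[_]; apply/negP/off; rewrite !inE eqxx ?orbT.
Qed.

Lemma involution_generated (H : set (selfhomeo T)) (s : seq V) f :
  group_closed [in H] ->
  (forall f' U W, full_group a f' -> apart s U -> apart s W ->
     (forall y, f' y != y -> U y || W y) -> H f') ->
  full_group a f -> (forall x, f (f x) = x) -> H f.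
Proof.
move=> Hg Hthin Ff f2; apply: (full_group_fragment Hg Ff) => x.
have [U0 [U0c U0x aU0]] := apart_nbhd s x.
have [U1 [U1c U1x aU1]] := apart_nbhd s (f x).
pose U y := U0 y && U1 (f y).
have Uc : loc_const U by apply: (loc_const_map2 andb) => //; exact: loc_const_homeo.
exists (fun y => U y || U (f y)); split.
- by apply: (loc_const_map2 orb) => //; exact: loc_const_homeo.
- by rewrite /U U0x U1x.
- by move=> y; rewrite f2 orbC.
move=> K f' Kc Kf KU Ff' f'E; apply: (Hthin f' U (fun y => U (f y))) => //.
- by apply: apart_sub aU0 => // y /andP[].
- by apply: apart_sub aU1 => // y /andP[_]; rewrite f2.
- by move=> y; rewrite f'E; case: ifP; rewrite ?eqxx // => /KU.
Qed.

(** First-fit along a finite cover by sets disjoint from their image wherever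
    [f] moves points: a point refused at its turn has its image or its preimage
    already chosen. *)
Lemma disjoint_from_image f : full_group a f ->
  exists W : T -> bool, [/\ loc_const W, forall y, W y -> ~~ W (f y) &
    forall y, f y != y -> [|| W y, W (f y) | W (f^-1%g y)]].
Proof.
move=> Ff; have moved := moved_loc_const Ff.
have /choice[U PU] : forall x, exists U, [/\ loc_const U, U x &
    forall y, U y -> f y != y -> ~~ U (f y)].
  move=> x; have [fx|] := eqVneq (f x) x.
    exists (fun y => ~~ (f y != y)); split; first exact: (loc_const_map negb).
    + by rewrite fx eqxx.
    + by move=> y /negP.
  rewrite eq_sym => /T_sep[u uc /andP[ux ufx]].
  exists (fun y => u y && ~~ u (f y)); split.
  - apply: (loc_const_map2 (fun b c => b && ~~ c)) => //; exact: loc_const_homeo.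
  - by rewrite ux.
  - by move=> y /andP[uy ufy] _; rewrite (negPf ufy).
have [x|x|s Ps] := finite_cover T_compact (U := U); try by case: (PU x).
suff [W [Wc WfW Wmax]] : exists W : T -> bool, [/\ loc_const W,
    forall y, W y -> ~~ W (f y) &
    forall y, f y != y -> has (U^~ y) s -> [|| W y, W (f y) | W (f^-1%g y)]].
  by exists W; split=> // y fy; apply: Wmax.
elim: s {Ps} => [|x s [W [Wc WfW Wmax]]].
  by exists (fun=> false); split=> //; exact: loc_const_cst.
have [Uc _ Uf] := PU x.
pose N y := (f y != y) && (U x y && ~~ (W (f y) || W (f^-1%g y))).
exists (fun y => W y || N y); split.
- apply: (loc_const_map2 orb) => //; apply: (loc_const_map2 andb) => //.
  apply: (loc_const_map2 (fun b c => b && ~~ c)) => //.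
  by apply: (loc_const_map2 orb); exact: loc_const_homeo.
- move=> y /orP[Wy|/and3P[fy Uy]]; rewrite negb_or.
    by rewrite WfW //= /N homeo_VK Wy !orbT !andbF.
  by rewrite negb_or => /andP[Wfy _]; rewrite Wfy /N (negPf (Uf _ Uy fy)) !andbF.
- move=> y fy /= /orP[Uy|/(Wmax y fy)]; last by case/or3P => ->; rewrite ?orbT.
  rewrite /N fy Uy /=; case: (W y) => //=.
  by case: (W (f y)); case: (W (f^-1%g y)); rewrite //= ?orbT.
Qed.

(** Multiplying [f] by the involution that exchanges [W] and [f W] through [f]
    produces an element that is trivial on [W]. *)
Lemma split_involution f (W : T -> bool) : full_group a f -> loc_const W ->
  (forall y, W y -> ~~ W (f y)) ->
  exists2 t, full_group a t /\ (forall x, t (t x) = x) &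
    forall y, (t * f)%g y != y -> (f y != y) && ~~ W y.
Proof.
move=> Ff Wc WfW.
have [phi phic fE] := (full_groupP f).1 Ff.
have [psi psic fVE] := (full_groupP f^-1%g).1 (full_groupV Ff).
pose theta x := if W x then phi x else if W (f^-1%g x) then psi x else 0.
have thetac : loc_const theta.
  apply: loc_const_if => //; apply: loc_const_if => //; last exact: loc_const_cst.
  exact: loc_const_homeo.
have thetaE x : move theta x = if W x then f x else if W (f^-1%g x) then f^-1%g x else x.
  by rewrite /move /theta fE fVE; do ![case: ifP => // _]; rewrite act0.
have theta2 x : move theta (move theta x) = x.
  rewrite !thetaE; case: (boolP (W x)) => Wx.
    by rewrite homeo_VK Wx (negPf (WfW _ Wx)).
  case: (boolP (W (f^-1%g x))) => Wfx; first by rewrite Wfx homeo_KV.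
  by rewrite (negPf Wx) (negPf Wfx).
have [t Ft tE] := full_group_make thetac thetac theta2 theta2.
exists t; first by split=> // x; rewrite !tE.
move=> y; rewrite homeo_mulE tE thetaE homeo_VK.
case: (boolP (W y)) => Wy; first by rewrite (negPf (WfW _ Wy)) eqxx.
rewrite andbT; apply: contra_neq => fy.
by rewrite fy (negPf Wy).
Qed.

End FullGroup.

(** * Commutators modulo elements of order three *)

Section LatticeAction.
Context {d : nat} {T : topologicalType} (a : 'rV[int]_d -> selfhomeo T).
Context (aP : free_cantor_action a).
Implicit Types (f c : selfhomeo T) (x y : T) (g h k : 'rV[int]_d).
Implicit Types (U W P Q S : T -> bool) (R r : nat).

Definition visits R U x : nat := count (fun g => U (a g x)) (box R).

Lemma visits_size R U x : (visits R U x <= size (box (d := d) R))%N.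
Proof. exact: count_size. Qed.

Lemma visits_or R P U W x : (forall y, P y -> U y || W y) ->
  (visits R P x <= visits R U x + visits R W x)%N.
Proof.
move=> PUW; rewrite /visits -count_predUI (leq_trans _ (leq_addr _ _)) //.
by apply: sub_count => g; apply: PUW.
Qed.

Lemma visits_disjoint R P U W x : (forall y, U y -> P y) -> (forall y, W y -> P y) ->
  (forall y, U y -> ~~ W y) -> (visits R U x + visits R W x <= visits R P x)%N.
Proof.
move=> UP WP UW; rewrite /visits -count_predUI [X in (_ + X)%N](_ : _ = 0%N) ?addn0.
  by apply: sub_count => g /orP[/UP|/WP].
rewrite (@eq_count _ _ pred0) ?count_pred0 // => g /=.
by case: (boolP (U (a g x))) => //= /UW/negPf.
Qed.

(** An injection of displacement at most [r] moves visits within a box to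
    visits within a slightly larger box. *)
Lemma visits_shift (theta : T -> T) P Q R r x : injective theta ->
  (forall y, P y -> Q (theta y) /\ exists2 k, k \in box r & theta y = a k y) ->
  (visits R P x <= visits (R + r) Q x)%N.
Proof.
move=> th_inj thP.
have /choice[k kP] : forall y, exists k, P y -> k \in box r /\ theta y = a k y.
  move=> y; case: (boolP (P y)) => [/thP[_ [k kr kE]]|]; first by exists k.
  by exists 0.
rewrite /visits -!size_filter.
pose F g := g + k (a g x); rewrite -(size_map F).
have thF g : P (a g x) -> theta (a g x) = a (F g) x.
  by move=> Pg; have [_ ->] := kP _ Pg; rewrite /F addrC (actD aP).
apply: uniq_leq_size.
  rewrite map_inj_in_uniq ?filter_uniq ?box_uniq // => g1 g2.
  rewrite !mem_filter => /andP[P1 _] /andP[P2 _] E.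
  by apply: (act_free aP (x := x)); apply: th_inj; rewrite !thF // E.
move=> _ /mapP[g + ->]; rewrite !mem_filter => /andP[Pg gR].
rewrite -thF //; have [-> _] := thP _ Pg; have [kr _] := kP _ Pg.
exact: boxD.
Qed.

Lemma visits_mono R r U x : (R <= r)%N -> (visits R U x <= visits r U x)%N.
Proof.
move=> Rr; rewrite /visits -!size_filter uniq_leq_size ?filter_uniq ?box_uniq //.
by move=> g; rewrite !mem_filter => /andP[-> /(box_mono Rr)].
Qed.

Lemma size_le1 (X : eqType) (s : seq X) : uniq s -> {in s &, forall u v, u = v} ->
  (size s <= 1)%N.
Proof.
case: s => [|u [|v s]] //= /andP[uvs _] /(_ u v).
rewrite !inE !eqxx orbT => /(_ isT isT) uv.
by move: uvs; rewrite uv mem_head.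
Qed.

Lemma visits_apart R U x : apart a (box (R + R)) U -> (visits R U x <= 1)%N.
Proof.
move=> aU; rewrite /visits -size_filter; apply: size_le1; first exact/filter_uniq/box_uniq.
move=> g h; rewrite !mem_filter => /andP[Ug gR] /andP[Uh hR].
apply/eqP/negPn/negP => gh.
have := aU (h - g); rewrite box_sub // subr_eq0 eq_sym gh => /(_ isT isT (a g x) Ug).
by rewrite -(actD aP) subrK Uh.
Qed.

Lemma full_group_displacement f : full_group a f ->
  exists r, forall x, exists2 k, k \in box r & f x = a k x.
Proof.
case/(full_group_bounded aP) => s Hs; have [r sr] := sub_some_box s.
by exists r => x; have [k /sr kr ->] := Hs x; exists k.
Qed.

Definition moved f x := f x != x.

(** Two thirds of the mass of the support survive at most: each point of the new
    support is sent by [f] or its inverse into [W], which has been removed. *)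
Lemma shrink_support f : full_group a f ->
  exists t r, [/\ full_group a t, forall x, t (t x) = x &
    forall R x, (3 * visits R (moved (t * f)%g) x <= 2 * visits (R + r) (moved f) x)%N].
Proof.
move=> Ff; have [W [Wc WfW Wmax]] := disjoint_from_image aP Ff.
have [t [Ft t2] tf] := split_involution aP Ff Wc WfW.
have [r1 Hr1] := full_group_displacement Ff.
have [r2 Hr2] := full_group_displacement (full_groupV aP Ff).
exists t, (r1 + r2)%N; split=> // R x.
have le1 : (visits R (fun y => W (f y)) x <= visits (R + (r1 + r2)) W x)%N.
  apply: visits_shift (@homeo_inj _ f) _ => y Wfy; split=> //.
  by have [k kr ->] := Hr1 y; exists k => //; apply: box_mono kr; lia.
have le2 : (visits R (fun y => W (f^-1%g y)) x <= visits (R + (r1 + r2)) W x)%N.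
  apply: visits_shift (@homeo_inj _ f^-1%g) _ => y Wfy; split=> //.
  by have [k kr ->] := Hr2 y; exists k => //; apply: box_mono kr; lia.
have le3 : (visits R (moved (t * f)%g) x <=
            visits R (fun y => W (f y)) x + visits R (fun y => W (f^-1%g y)) x)%N.
  by apply: visits_or => y /tf/andP[/Wmax + /negPf Wy]; rewrite Wy.
have le4 : (visits (R + (r1 + r2)) W x + visits (R + (r1 + r2)) (moved (t * f)%g) x
            <= visits (R + (r1 + r2)) (moved f) x)%N.
  apply: visits_disjoint => y.
  - by move=> Wy; apply/eqP => fy; have := WfW y Wy; rewrite fy Wy.
  - by move=> /tf/andP[].
  - by move=> Wy; apply/negP => /tf/andP[_]; rewrite Wy.
have le5 : (visits R (moved (t * f)%g) x <= visits (R + (r1 + r2)) (moved (t * f)%g) x)%N.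
  by apply: visits_mono; exact: leq_addr.
lia.
Qed.

Definition involutions : set (selfhomeo T) :=
  [set t | full_group a t /\ forall x, t (t x) = x].

Lemma shrink_support_iter n f : full_group a f ->
  exists t f' r, [/\ generated involutions t, full_group a f', f = (t * f')%g &
    forall R x, (3 ^ n * visits R (moved f') x <= 2 ^ n * visits (R + r) (moved f) x)%N].
Proof.
move=> Ff; have /group_closedE[G1 GM _] := generated_group involutions.
elim: n => [|n [t [f' [r [Gt Ff' fE le]]]]].
  by exists 1%g, f, 0%N; split; rewrite ?mul1g // => R x; rewrite addn0.
have [t' [r' [Ft' t'2 le']]] := shrink_support Ff'.
exists (t * t')%g, (t' * f')%g, (r' + r)%N; split.
- by apply: GM => //; apply: sub_generated.
- exact: (full_groupM aP Ft' Ff').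
- by rewrite fE; apply: homeo_ext => x; rewrite !homeo_mulE t'2.
- move=> R x; rewrite !expnSr -mulnA.
  apply: (leq_trans (leq_mul (leqnn _) (le' R x))).
  by rewrite mulnCA [(2 ^ n * 2)%N]mulnC -mulnA leq_mul2l addnA le orbT.
Qed.

(** The constant [8] leaves room, in each box, for two disjoint copies of a thin
    set away from itself and from another thin set.  Visits are counted in the
    box of double size because the copies are taken at distance at most [R]. *)
Definition thin R U := forall x, (8 * visits (R + R) U x <= size (box (d := d) R))%N.

Definition thin_elements R : set (selfhomeo T) :=
  [set f | full_group a f /\ thin R (moved f)].

Lemma involution_thin R t : (0 < d)%N -> (8 <= R)%N -> involutions t ->
  generated (thin_elements R) t.
Proof.
move=> d0 R8 [Ft t2].
apply: (involution_generated aP (s := box (R.*2.*2)) (generated_group _)) => //.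
move=> f' U W Ff' aU aW f'UW; apply: sub_generated; split=> // x.
have E : (R + R + (R + R) = R.*2.*2)%N by lia.
have vU : (visits (R + R) U x <= 1)%N by apply: visits_apart; rewrite E.
have vW : (visits (R + R) W x <= 1)%N by apply: visits_apart; rewrite E.
have := visits_or (R + R) x f'UW; have := ltn_size_box R d0; rewrite -/(moved f').
by move: (visits _ (moved f') x) (size _) vU vW => *; lia.
Qed.

(** With [m = 3 + 2 n], one has [9 ^ m >= 8 ^ m = 2 ^ m * 4 ^ m], and [2 ^ m] is
    [8 * 4 ^ n]. *)
Lemma geometric_gap n : (8 * 3 ^ n * 2 ^ ((3 + n.*2).*2) <= 3 ^ (3 + n.*2).*2)%N.
Proof.
rewrite -!mul2n !expnM -[(2 ^ 2)%N]/4%N -[(3 ^ 2)%N]/9%N.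
apply: (@leq_trans (8 ^ (3 + 2 * n))); last by rewrite leq_exp2r.
rewrite -[8%N in leqRHS]/(2 * 4)%N expnMn leq_mul2r; apply/orP; right.
by rewrite expnD expnM leq_mul2l; case: n => // n; rewrite leq_exp2r.
Qed.

(** Any element is a product of involutions and of an element with support of
    small density, and involutions can be cut into elements of small support. *)
Lemma thin_generated f : (0 < d)%N -> full_group a f ->
  exists R0, forall R, (R0 <= R)%N -> generated (thin_elements R) f.
Proof.
move=> d0 Ff.
have [t [f' [r [Gt Ff' fE le]]]] := shrink_support_iter (3 + d.*2).*2 Ff.
exists (r + 8)%N => R Rr; have /group_closedE[_ GM _] := generated_group (thin_elements R).
rewrite fE; apply: GM.
  suff sub : generated involutions `<=` generated (thin_elements R) by exact: sub.
  apply: generated_sub; first exact: generated_group.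
  by move=> j; apply: involution_thin => //; lia.
apply: sub_generated; split=> // x; rewrite -(leq_pmul2l (m := 3 ^ (3 + d.*2).*2)) ?expn_gt0 //.
rewrite mulnCA; apply: (leq_trans (leq_mul (leqnn 8) (le _ x))).
have size3 : (visits (R + R + r) (moved f) x <= 3 ^ d * size (box (d := d) R))%N.
  apply: leq_trans (leq_size_box3 R); apply: leq_trans (visits_size (R * 3) (moved f) x).
  by apply: visits_mono; lia.
apply: (leq_trans (leq_mul (leqnn 8) (leq_mul (leqnn _) size3))).
apply: leq_trans (leq_mul (geometric_gap d) (leqnn _)).
by move: (expn 2 _) (expn 3 d) (size _) => p q n; rewrite !mulnA (mulnAC 8).
Qed.

Definition order3 : set (selfhomeo T) :=
  [set c | full_group a c /\ forall x, c (c (c x)) = x].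

Lemma order3_sub : generated order3 `<=` full_group a.
Proof. by apply: generated_sub => [|f []]; first exact: full_group_group. Qed.

Lemma order3_normal n f : generated order3 n -> full_group a f ->
  generated order3 (n ^ f)%g.
Proof.
move=> Gn Ff; have /group_closedE[G1 GM GV] := generated_group order3.
suff sub : generated order3 `<=` [set m | generated order3 (m ^ f)%g] by exact: sub.
apply: generated_sub.
  apply/group_closedE; split=> /=.
  - by rewrite conj1g.
  - by move=> x y Gx Gy; rewrite conjMg; exact: GM.
  - by move=> x Gx; rewrite conjVg; exact: GV.
move=> c [Fc c3] /=; apply: sub_generated; split.
  apply: (full_groupM aP); first exact: (full_groupV aP Ff).
  exact: (full_groupM aP).
by move=> x; rewrite conjgE !homeo_mulE !homeo_KV c3 homeo_VK.
Qed.

Lemma cycle3_order3 U (p q r : 'rV[int]_d) : loc_const U -> uniq [:: p; q; r] ->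
  apart a (diffs [:: p; q; r]) U -> order3 (cycle3 a U p q r).
Proof.
move=> Uc u3 aU; split; first exact: (cycle3_spec aP Uc u3 aU).1.
set L := [:: p; q; r] in u3 aU * => x.
have step l y : l \in L -> U y -> cycle3 a U p q r (a l y) = a (cycle_label p q r l) y.
  by move=> lL Uy; rewrite (cycle3E aP (L := L) (Q := U)) // Uy.
case: (labelP aP L U x) => [[l [y [lL Uy ->]]] | off].
  rewrite !step ?cycle_label_in //.
  move: lL u3; rewrite /L /= !inE negb_or andbT => lL /andP[/andP[pq pr] qr].
  have E1 : cycle_label p q r p = q by rewrite /cycle_label eqxx.
  have E2 : cycle_label p q r q = r by rewrite /cycle_label eq_sym (negPf pq) eqxx.
  have E3 : cycle_label p q r r = p.
    by rewrite /cycle_label (eq_sym r p) (negPf pr) (eq_sym r q) (negPf qr) eqxx.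
  by case/or3P: lL => /eqP ->; rewrite !(E1, E2, E3).
by rewrite !(cycle3_off aP) ?off ?inE ?eqxx ?orbT.
Qed.

(** A first-fit construction: the pieces [U z] and the pairs of translations are
    scanned, and each point of [S] not yet moved is inserted in a three-cycle
    with its two translates as soon as both of them are free.  The last clause
    is the invariant that a pair already scanned has no two free translates at
    an unmoved point. *)
Lemma first_fit (R : nat) (S S' : T -> bool) (U : T -> T -> bool)
    (l : seq (T * ('rV[int]_d * 'rV[int]_d))) :
  loc_const S -> loc_const S' -> (forall z, loc_const (U z)) ->
  (forall z, apart a (box (R + R)) (U z)) ->
  (forall w, w \in l -> w.2.1 \in box R /\ w.2.2 \in box R) ->
  exists c, [/\ generated order3 c,
    forall x, S x -> moved c x -> ~~ S (c x) && ~~ S' (c x),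
    forall y, moved c y -> S y \/ exists x k,
      [/\ S x, k \in box R, y = a k x & c x = y \/ c (c x) = y] &
    forall w, w \in l -> uniq [:: 0; w.2.1; w.2.2] -> forall x, U w.1 x -> S x ->
      [|| moved c x, [|| S (a w.2.1 x), S' (a w.2.1 x) | moved c (a w.2.1 x)]
        | [|| S (a w.2.2 x), S' (a w.2.2 x) | moved c (a w.2.2 x)]]].
Proof.
move=> Sc S'c Uc aU; have /group_closedE[G1 GM GV] := generated_group order3.
elim: l => [|[z [g h]] l IH] box_l.
  exists 1%g; split=> //; move=> x; rewrite /moved homeo_oneE eqxx //.
have [|c [Gc cS cO cl]] := IH; first by move=> w wl; apply: box_l; rewrite inE wl orbT.
have [/= gR hR] := box_l _ (mem_head _ _).
have [u3|nu3] := boolP (uniq [:: 0; g; h]); last first.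
  exists c; split=> // w; rewrite inE => /predU1P[->|wl]; last exact: cl.
  by move=> u3; case/negP: nu3.
pose O y := [|| S y, S' y | moved c y].
have cc : loc_const (moved c) by apply: (moved_loc_const aP); exact: order3_sub.
have Oc : loc_const O by apply: (loc_const_map2 orb) => //; exact: (loc_const_map2 orb).
pose V y := [&& U z y, S y, ~~ moved c y, ~~ O (a g y) & ~~ O (a h y)].
have Vc : loc_const V.
  have Ogc k : loc_const (fun y => ~~ O (a k y)).
    by apply: (loc_const_map negb); exact: loc_const_homeo.
  by do 3![apply: (loc_const_map2 andb) => //]; [exact: (loc_const_map negb)|exact: (loc_const_map2 andb)].
set L := [:: 0; g; h] in u3.
have LR k : k \in L -> k \in box R.
  by rewrite !inE => /or3P[] /eqP -> //; exact: box0.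
have aV : apart a (diffs L) V.
  apply: (apart_sub _ _ (aU z)); last by move=> y /andP[].
  by move=> _ /allpairsP[[m n] [/= mL nL ->]]; apply: box_sub; apply: LR.
pose t := cycle3 a V 0 g h.
move: (u3); rewrite /= !inE negb_or andbT => /andP[/andP[g0 h0] gh].
have tE k y : k \in L -> V y -> t (a k y) = a (cycle_label 0 g h k) y.
  by move=> kL Vy; rewrite /t (cycle3E aP (L := L) (Q := V)) // Vy.
have t0 y : V y -> t y = a g y.
  by move=> Vy; rewrite -{1}[y](act0 aP) tE ?inE ?eqxx // /cycle_label eqxx.
have tg y : V y -> t (a g y) = a h y.
  by move=> Vy; rewrite tE ?inE ?eqxx ?orbT // /cycle_label eq_sym (negPf g0) eqxx.
have th y : V y -> t (a h y) = y.
  move=> Vy; rewrite tE ?inE ?eqxx ?orbT // /cycle_label eq_sym (negPf h0).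
  by rewrite eq_sym (negPf gh) eqxx (act0 aP).
have cL k y : k \in L -> V y -> c (a k y) = a k y.
  move=> + /and5P[_ _ ncy nOg nOh]; rewrite !inE => /or3P[] /eqP ->.
  - by apply/eqP; move: ncy; rewrite (act0 aP) negbK.
  - by move: nOg; rewrite !negb_or => /and3P[_ _ /negPn/eqP].
  - by move: nOh; rewrite !negb_or => /and3P[_ _ /negPn/eqP].
have toff y : (exists k x, [/\ k \in L, V x & y = a k x]) \/ t y = y.
  case: (labelP aP L V y) => [|off]; [by left | right].
  by apply: (cycle3_off aP) => //; apply: off; rewrite !inE eqxx ?orbT.
have cmoved y : moved c y -> (c * t)%g y = c y.
  move=> cy; case: (toff y) => [[k [x [kL Vx yE]]]|ty]; last by rewrite homeo_mulE ty.
  by move: cy; rewrite /moved yE cL ?eqxx.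
have sub_moved y : moved c y -> moved (c * t)%g y by move=> cy; rewrite /moved cmoved.
exists (c * t)%g; split.
- by apply: GM => //; apply: sub_generated; exact: cycle3_order3.
- move=> x Sx; case: (toff x) => [[k [y [kL Vy xE]]]|tx].
    have /and5P[_ Sy _ nOg nOh] := Vy; move: kL xE; rewrite !inE => /or3P[] /eqP -> xE _.
    + rewrite homeo_mulE xE (act0 aP) t0 // cL // ?inE ?eqxx ?orbT //.
      by move: nOg; rewrite !negb_or => /and3P[-> -> _].
    + by move: nOg; rewrite -xE /O Sx.
    + by move: nOh; rewrite -xE /O Sx.
  by rewrite /moved homeo_mulE tx; exact: cS.
- move=> y; case: (toff y) => [[k [x [kL Vx yE]]] _|ty].
    have /and5P[_ Sx _ _ _] := Vx; move: kL yE; rewrite !inE => /or3P[] /eqP -> yE.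
    + by left; rewrite yE (act0 aP).
    + right; exists x, g; split=> //; left.
      by rewrite homeo_mulE t0 // cL // !inE eqxx orbT.
    + right; exists x, h; split=> //; right.
      rewrite !homeo_mulE (t0 x) // (cL g x) ?inE ?eqxx ?orbT // tg //.
      by rewrite cL // !inE eqxx !orbT.
  rewrite {1}/moved homeo_mulE ty => cy; case: (cO y cy) => [|[x [k [Sx kR yE cxy]]]].
    by left.
  have cx : moved c x.
    apply: contra_neq cy => cx; case: cxy; rewrite ?cx => xy; by rewrite -xy.
  have ccx : moved c (c x) by rewrite /moved (inj_eq (@homeo_inj _ c)).
  by right; exists x, k; split=> //; rewrite !cmoved.
- move=> w; rewrite inE => /predU1P[->|wl] u3w x Uwx Sx.
    rewrite /=; case: (boolP (V x)) => [Vx|].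
      suff -> : moved (c * t)%g x by [].
      rewrite /moved homeo_mulE t0 // cL ?inE ?eqxx ?orbT //.
      by rewrite (act_eq aP) eq_sym.
    rewrite /V Uwx Sx /= !negb_and !negbK => /or3P[/sub_moved -> //| |].
      by case/or3P => [->|->|/sub_moved ->]; rewrite !orbT.
    by case/or3P => [->|->|/sub_moved ->]; rewrite !orbT.
  case/or3P: (cl w wl u3w x Uwx Sx) => [/sub_moved -> //| |].
    by case/or3P => [->|->|/sub_moved ->]; rewrite !orbT.
  by case/or3P => [->|->|/sub_moved ->]; rewrite !orbT.
Qed.

(** If a point of [S] were left unmoved by the first-fit element, all but one of
    its translates in a box would lie in [S], in [S'] or in the support of that
    element; counting shows that this is too many. *)
Lemma displace_thin R S S' : (0 < d)%N -> (0 < R)%N -> loc_const S -> loc_const S' ->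
  thin R S -> thin R S' ->
  exists2 c, generated order3 c & forall x, S x -> ~~ S' (c x).
Proof.
move=> d0 R0 Sc S'c thinS thinS'.
have /choice[U PU] := apart_nbhd aP (box (R + R)).
have [x|x|s Us] := finite_cover (space_compact aP) (U := U); try by case: (PU x).
pose l := [seq (z, gh) | z <- s, gh <- [seq (g, h) | g <- box R, h <- box R]].
have [||w|c [Gc cS cO cl]] := @first_fit R S S' U l Sc S'c.
- by move=> z; case: (PU z).
- by move=> z; case: (PU z).
- by case/allpairsP => [[z gh] [_ /allpairsP[[g h] [/= gR hR ->]] ->]].
exists c => // x Sx; suff cx : moved c x by case/andP: (cS x Sx cx).
case: (boolP (moved c x)) => // ncx; exfalso.
pose O y := [|| S y, S' y | moved c y].
have [z zs Uzx] := hasP (Us x).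
have two g h : g \in box R -> h \in box R -> uniq [:: 0; g; h] -> O (a g x) || O (a h x).
  move=> gR hR u3; have := cl (z, (g, h)); rewrite /= => /(_ _ u3 x Uzx Sx).
  rewrite (negPf ncx) /=; apply.
  by apply: allpairs_f => //; apply: allpairs_f.
(* Two free translates would have been used to move [x]. *)
have free_le1 : (visits R (fun y => ~~ O y) x <= 1)%N.
  rewrite /visits -size_filter; apply: size_le1; first exact/filter_uniq/box_uniq.
  move=> g h; rewrite !mem_filter => /andP[nOg gR] /andP[nOh hR].
  have nO0 k : ~~ O (a k x) -> 0 != k.
    by apply: contraNneq => <-; rewrite (act0 aP) /O Sx.
  apply/eqP/negPn/negP => gh; have := two g h gR hR.
  rewrite (negPf nOg) (negPf nOh) /= !inE negb_or (nO0 g) // (nO0 h) // gh.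
  by move=> /(_ isT).
have total : (visits R O x + visits R (fun y => ~~ O y) x = size (box (d := d) R))%N.
  exact: count_predC.
(* The support is made of [S] and of first and second images of points of [S]. *)
pose P1 y := `[< exists x k, [/\ S x, k \in box R, y = a k x & c x = y] >].
pose P2 y := `[< exists x k, [/\ S x, k \in box R, y = a k x & c (c x) = y] >].
have le1 : (visits R P1 x <= visits (R + R) S x)%N.
  apply: visits_shift (@homeo_inj _ c^-1%g) _ => y /asboolP[w [k [Sw kR yE cw]]].
  have -> : (c^-1%g y) = w by rewrite -cw homeo_VK.
  split=> //; exists (- k); first by rewrite boxN.
  by rewrite yE (actNK aP).
have le2 : (visits R P2 x <= visits (R + R) S x)%N.
  apply: visits_shift (@homeo_inj _ (c^-1 * c^-1)%g) _ => y /asboolP[w [k [Sw kR yE cw]]].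
  have -> : (c^-1 * c^-1)%g y = w by rewrite -cw homeo_mulE !homeo_VK.
  split=> //; exists (- k); first by rewrite boxN.
  by rewrite yE (actNK aP).
have leO : (visits R O x <= visits R S x + visits R S' x + (visits R P1 x + visits R P2 x))%N.
  have := @visits_or R O (fun y => S y || S' y) (fun y => P1 y || P2 y) x.
  have := @visits_or R (fun y => S y || S' y) S S' x (fun _ => id).
  have := @visits_or R (fun y => P1 y || P2 y) P1 P2 x (fun _ => id).
  move=> h1 h2 h3; apply: (leq_trans (h3 _)); last exact: leq_add.
  move=> y /or3P[->|->|/cO[->|[w [k [Sw kR yE cw]]]]]; rewrite ?orbT //.
  apply/orP; right; apply/orP.
  by case: cw => cw; [left | right]; apply/asboolP; exists w, k.
have leS : (visits R S x <= visits (R + R) S x)%N by apply: visits_mono; exact: leq_addr.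
have leS' : (visits R S' x <= visits (R + R) S' x)%N by apply: visits_mono; exact: leq_addr.
have := thinS x; have := thinS' x; have := ltn_size_box R d0.
move: total leO le1 le2 leS leS' free_le1; move: (visits _ _ _) (visits _ _ _) (visits _ _ _)
  (visits _ _ _) (visits _ _ _) (visits _ _ _) (visits _ _ _) (visits _ _ _) (size _) => *; lia.
Qed.

Lemma commute_disjoint_support f f' :
  (forall x, moved f x -> ~~ moved f' x) -> commute f f'.
Proof.
move=> dis; apply: homeo_ext => x; rewrite !homeo_mulE.
have fix_of (h : selfhomeo T) y : ~~ moved h y -> h y = y by move/negPn/eqP.
have [f'x|f'x] := boolP (moved f' x).
  have fx : f x = x by apply: fix_of; apply: contraL f'x; exact: dis.
  have f'f'x : moved f' (f' x) by rewrite /moved (inj_eq (@homeo_inj _ f')).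
  by rewrite fx fix_of //; apply: contraL f'f'x; exact: dis.
rewrite (fix_of f') //; have [fx|/fix_of fx] := boolP (moved f x); last by rewrite fx fix_of.
have ffx : moved f (f x) by rewrite /moved (inj_eq (@homeo_inj _ f)).
by rewrite (fix_of f') // dis.
Qed.

(** The full group is commutative modulo its elements of order three: it is
    generated by thin elements, and modulo those elements one may push the
    support of a thin element off the support of another one. *)
Lemma commutator_order3 f f' : (0 < d)%N -> full_group a f -> full_group a f' ->
  generated order3 [~ f, f']%g.
Proof.
move=> d0 /(thin_generated d0)[r1 G1] /(thin_generated d0)[r2 G2].
pose R := (r1 + r2 + 1)%N.
have := commutator_generated (full_group_group aP) (generated_group order3)
  order3_normal (A := thin_elements R); apply; last 2 first.
- by apply: G1; rewrite /R; lia.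
- by apply: G2; rewrite /R; lia.
- by move=> h [].
move=> h h' [Fh thinh] [Fh' thinh'].
have [||||||c Gc cdis] := @displace_thin R (moved h) (moved h') => //.
- by rewrite /R; lia.
- exact: (moved_loc_const aP).
- exact: (moved_loc_const aP).
have /group_closedE[_ _ GV] := generated_group order3.
apply: (commutator_conjugate (full_group_group aP) (generated_group order3)
  order3_normal (c := c^-1%g)) => //.
- by apply: (full_groupV aP); exact: order3_sub.
- exact: GV.
apply: commute_disjoint_support => x hx.
suff hcx : moved h (c^-1%g x) by have := cdis _ hcx; rewrite homeo_KV.
apply: contra_neq hx => hx; by rewrite conjgE !homeo_mulE hx invgK homeo_KV.
Qed.

End LatticeAction.

(** * Finitely many three-cycles suffice *)

Section LabelSpread.
Context {V : zmodType} {T : topologicalType} (a : V -> selfhomeo T).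
Context (aP : free_cantor_action a) (H : set (selfhomeo T)) (Hg : group_closed [in H]).
Implicit Types (U W Q : T -> bool) (L I : seq V) (p q r : V).

Definition cycles_in L U := forall p q r, uniq [:: p; q; r] ->
  {subset [:: p; q; r] <= L} -> H (cycle3 a U p q r).

Lemma cycles_in_sub L L' U : {subset L' <= L} -> cycles_in L U -> cycles_in L' U.
Proof. by move=> sL c p q r u3 sub; apply: c => // l /sub/sL. Qed.

Lemma group_commg f f' : H f -> H f' -> H [~ f, f']%g.
Proof.
have [_ HM HV] := (group_closedE H).1 Hg.
move=> Hf Hf'; rewrite commgEl conjgE.
by apply: (HM); [exact: HV | apply: (HM); [exact: HV | exact: HM]].
Qed.

Lemma subset3 L p q r : p \in L -> q \in L -> r \in L -> {subset [:: p; q; r] <= L}.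
Proof. by move=> pL qL rL l; rewrite !inE => /or3P[] /eqP ->. Qed.

Lemma two_more (X : eqType) (I : seq X) (s : seq X) : uniq I -> (size s + 2 <= size I)%N ->
  exists u v, [/\ u \in I, v \in I & u \notin s /\ v \notin u :: s].
Proof.
move=> uI sI; have avoid (s' : seq X) : (size s' < size I)%N ->
    exists2 u, u \in I & u \notin s'.
  move=> ltI; apply/hasP; rewrite has_predC; apply: contraL ltI => /allP sub.
  by rewrite -leqNgt uniq_leq_size.
have [|u uIn us] := avoid s; first by lia.
by have [|v vIn vs] := avoid (u :: s); [rewrite /=; lia | exists u, v].
Qed.

Lemma cycles_in_rule L Q U W p q q' r r' :
  loc_const U -> loc_const W -> (forall x, U x -> Q x) -> (forall x, W x -> Q x) ->
  apart a (diffs L) Q -> uniq [:: p; q'; q; r'; r] ->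
  {subset [:: p; q'; q; r'; r] <= L} ->
  H (cycle3 a U p q' q) -> H (cycle3 a W p r' r) ->
  H (cycle3 a (fun x => U x && W x) p q r).
Proof.
move=> Uc Wc UQ WQ aQ u5 sub HU HW.
rewrite -(commutator_cycle3 aP Uc Wc UQ WQ u5); first exact: group_commg.
exact: (apart_translate _ _ aQ).
Qed.

(** Five common labels leave room to connect any two labels by commutators. *)
Lemma cycles_in_union L1 L2 I U W :
  loc_const U -> loc_const W -> (forall x, U x -> W x) ->
  apart a (diffs (L1 ++ L2)) W -> uniq I -> (5 <= size I)%N ->
  {subset I <= L1} -> {subset I <= L2} ->
  cycles_in L1 U -> cycles_in L2 W -> cycles_in (L1 ++ L2) U.
Proof.
move=> Uc Wc UW aW uI I5 I1 I2 c1 c2.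
set L := L1 ++ L2 in aW *.
have sL1 : {subset L1 <= L} by move=> l lL; rewrite mem_cat lL.
have sL2 : {subset L2 <= L} by move=> l lL; rewrite mem_cat lL orbT.
have sI : {subset I <= L} by move=> l /I1/sL1.
have sub5 p q' q r' r : p \in L -> q' \in L -> q \in L -> r' \in L -> r \in L ->
    {subset [:: p; q'; q; r'; r] <= L}.
  by move=> *; move=> l; rewrite !inE => /or4P[|||/orP[]] /eqP ->.
have UWE : (fun x => U x && W x) = U.
  by apply/funext => x; case: (boolP (U x)) => // /UW ->.
have WUE : (fun x => W x && U x) = U.
  by apply/funext => x; rewrite andbC -[RHS](congr1 (@^~ x) UWE).
have UUE : (fun x => U x && U x) = U by apply/funext => x; rewrite andbb.
have pick p q r : exists u v, [/\ u \in I, v \in I &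
    [/\ u != p, u != q & u != r] /\ [/\ v != u, v != p, v != q & v != r]].
  have [//|u [v [uIn vIn [+ +]]]] := @two_more _ I [:: p; q; r] uI.
  rewrite !inE !negb_or => /and3P[up uq ur] /and4P[vu vp vq vr].
  by exists u, v.
(* One label in each of [L1], [L2]: the two cycles share only the label [x]. *)
have s1 x p q : x \in I -> p \in L1 -> q \in L2 -> x != p -> x != q -> p != q ->
    H (cycle3 a U x p q) /\ H (cycle3 a U x q p).
  move=> xI pL qL xp xq pq; have [u [v [uIn vIn [[ux up uq] [vu vx vp vq]]]]] := pick x p q.
  have H1 : H (cycle3 a U x u p).
    apply: c1; first by rewrite /= !inE negb_or eq_sym ux xp up.
    by apply: subset3 => //; exact: I1.
  have H2 : H (cycle3 a W x v q).
    apply: c2; first by rewrite /= !inE negb_or eq_sym vx xq vq.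
    by apply: subset3 => //; exact: I2.
  split.
    rewrite -UWE; apply: (cycles_in_rule (Q := W) (L := L) (q' := u) (r' := v)) => //.
      rewrite /= !inE !negb_or (eq_sym x u) ux xp (eq_sym x v) vx xq up (eq_sym u v) vu uq.
      by rewrite (eq_sym p v) vp pq vq.
    by apply: sub5; first [exact: sI | exact: sL1 | exact: sL2].
  rewrite -WUE; apply: (cycles_in_rule (Q := W) (L := L) (q' := v) (r' := u)) => //.
    rewrite /= !inE !negb_or (eq_sym x u) ux xp (eq_sym x v) vx xq up vu (eq_sym q u) uq.
    by rewrite vp (eq_sym q p) pq vq.
  by apply: sub5; first [exact: sI | exact: sL1 | exact: sL2].
(* Cycles on [U] through a common label; those with labels in [L2] are not
   given, but arise from [s1] and a cycle on [W]. *)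
have s2 x p q : x \in I -> p \in L -> q \in L -> x != p -> x != q -> p != q ->
    H (cycle3 a U x p q).
  move=> xI; rewrite !mem_cat => /orP[] pL /orP[] qL xp xq pq.
  - apply: c1; first by rewrite /= !inE negb_or xp xq pq.
    by apply: subset3 => //; exact: I1.
  - by have [] := s1 x p q.
  - by have [] := s1 x q p; rewrite // eq_sym.
  - have [u [v [uIn vIn [[ux up uq] [vu vx vp vq]]]]] := pick x p q.
    rewrite -UWE; apply: (cycles_in_rule (Q := W) (L := L) (q' := u) (r' := v)) => //.
    + rewrite /= !inE !negb_or (eq_sym x u) ux xp (eq_sym x v) vx xq up (eq_sym u v) vu uq.
      by rewrite (eq_sym p v) vp pq vq.
    + by apply: sub5; first [exact: sI | exact: sL2].
    + by have [] := s1 x u p; rewrite // ?I1 // eq_sym.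
    + apply: c2; first by rewrite /= !inE negb_or eq_sym vx xq vq.
      by apply: subset3 => //; exact: I2.
have aU3 p q r : p \in L -> q \in L -> r \in L -> apart a (diffs [:: p; q; r]) U.
  by move=> pL qL rL; apply: (apart_translate (L := L) _ UW aW); exact: subset3.
move=> p q r u3 sub.
have [pL qL rL] : [/\ p \in L, q \in L & r \in L].
  by split; apply: sub; rewrite !inE eqxx ?orbT.
move: (u3); rewrite /= !inE negb_or andbT => /andP[/andP[pq pr] qr].
have [u [v [uIn vIn [[up uq ur] [vu vp vq vr]]]]] := pick p q r.
have rotH x y : x \in I -> y \in L -> x != p -> x != y -> y != p -> H (cycle3 a U p x y).
  move=> xI yL xp xy yp.
  rewrite (cycle3_rot aP) //; first exact: s2.
    by rewrite /= !inE negb_or eq_sym xp eq_sym yp xy.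
  by apply: aU3 => //; exact: sI.
rewrite -UUE; apply: (cycles_in_rule (Q := W) (L := L) (q' := u) (r' := v)) => //.
- rewrite /= !inE !negb_or (eq_sym p u) up pq (eq_sym p v) vp pr uq (eq_sym u v) vu ur.
  by rewrite (eq_sym q v) vq qr vr.
- by apply: sub5; first [exact: sI | by []].
- by apply: rotH; rewrite // eq_sym.
- by apply: rotH; rewrite // eq_sym.
Qed.

Lemma cycles_in_translate L U e :
  cycles_in L (fun x => U (a (- e) x)) -> cycles_in [seq l + e | l <- L] U.
Proof.
move=> c p q r u3 sub.
have back m : m \in [:: p; q; r] -> m - e \in L.
  by move=> /sub/mapP[l lL ->]; rewrite addrK.
rewrite -[p](subrK e) -[q](subrK e) -[r](subrK e) -(cycle3_translate aP).
apply: c; first by rewrite -(map_inj_uniq (addIr (- e))) /= in u3 *.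
by apply: subset3; apply: back; rewrite !inE eqxx ?orbT.
Qed.

Lemma apart_shift (s : seq V) U e : apart a s U -> apart a s (fun x => U (a e x)).
Proof.
move=> aU g gs g0 x Ux; rewrite -(actD aP) addrC (actD aP); exact: aU.
Qed.

End LabelSpread.

Section Generators.
Context {d : nat} {T : topologicalType} (a : 'rV[int]_d -> selfhomeo T).
Context (d0 : (0 < d)%N) (aP : free_cantor_action a).
Context {X : eqType} (lam : T -> X) (lam_lc : loc_const lam).
Context (lam_apart : forall x g, g \in box 8 -> g != 0 -> lam (a g x) != lam x).
Context (lam_expansive : forall x y, (forall g, lam (a g x) = lam (a g y)) -> x = y).
Implicit Types (U W : T -> bool) (p q r g e : 'rV[int]_d) (v w : X).

Definition cell v x : bool := lam x == v.
Definition piece v w e x : bool := (lam x == v) && (lam (a e x) == w).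

Lemma cell_loc_const v : loc_const (cell v).
Proof. exact: (loc_const_map (fun u => u == v)). Qed.

(** Labels are taken in the box of size [3], which a unit translation moves into
    the box of size [4]; differences of labels are then in the box of size [8]. *)
Lemma apart_cell v : apart a (box 8) (cell v).
Proof. by move=> g gs g0 x /eqP <-; exact: lam_apart. Qed.

Lemma diffs_box R (L : seq 'rV[int]_d) : {subset L <= box R} ->
  {subset diffs L <= box (R + R)}.
Proof. by move=> sL _ /allpairsP[[m n] [/= mL nL ->]]; apply: box_sub; apply: sL. Qed.

Lemma apart_cell_sub v R (L : seq 'rV[int]_d) U : (R <= 4)%N -> {subset L <= box R} ->
  (forall x, U x -> cell v x) -> apart a (diffs L) U.
Proof.
move=> R4 sL UC; apply: (apart_sub _ UC (@apart_cell v)) => g /(diffs_box sL).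
by apply: box_mono; lia.
Qed.

Lemma size_box2 R : (2 <= R)%N -> (5 <= size (box (d := d) R))%N.
Proof. by move=> R2; have := ltn_size_box R d0; lia. Qed.

Section Generated.
Context (H : set (selfhomeo T)) (Hg : group_closed [in H]).
Context (Hgen : forall v w e p q r, e \in box 1 -> uniq [:: p; q; r] ->
  {subset [:: p; q; r] <= box 3} -> H (cycle3 a (piece v w e) p q r)).

Definition good v U := cycles_in a H (box 3) (fun x => cell v x && U x).

Definition good_set U := loc_const U /\ forall v, good v U.

Lemma cell_and_loc_const v U : loc_const U -> loc_const (fun x => cell v x && U x).
Proof. by move=> Uc; apply: (loc_const_map2 andb) => //; exact: cell_loc_const. Qed.

Lemma goodI v U W : loc_const U -> loc_const W -> good v U -> good v W ->
  good v (fun x => U x && W x).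
Proof.
move=> Uc Wc gU gW p q r u3 sub.
have [|u [s [uB sB [+ +]]]] := @two_more _ (box 3) [:: p; q; r] (box_uniq 3).
  by have := ltn_size_box 3 d0; rewrite /=; lia.
rewrite !inE !negb_or => /and3P[up uq ur] /and4P[su sp sq sr].
have [pB qB rB] : [/\ p \in box 3, q \in box 3 & r \in box 3].
  by split; apply: sub; rewrite !inE eqxx ?orbT.
move: (u3); rewrite /= !inE negb_or andbT => /andP[/andP[pq pr] qr].
rewrite (_ : (fun x => _) = (fun x => (cell v x && U x) && (cell v x && W x))); last first.
  by apply/funext => x; case: (cell v x).
apply: (cycles_in_rule aP Hg (Q := cell v) (L := box 3) (q' := u) (r' := s)).
- exact: cell_and_loc_const.
- exact: cell_and_loc_const.
- by move=> x /andP[].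
- by move=> x /andP[].
- by apply: (apart_cell_sub (R := 3) (v := v)).
- rewrite /= !inE !negb_or (eq_sym p u) up pq (eq_sym p s) sp pr uq (eq_sym u s) su ur.
  by rewrite (eq_sym q s) sq qr sr.
- by move=> l; rewrite !inE => /or4P[|||/orP[]] /eqP ->.
- apply: gU; last exact: subset3.
  by rewrite /= !inE negb_or eq_sym up pq uq.
- apply: gW; last exact: subset3.
  by rewrite /= !inE negb_or eq_sym sp pr sr.
Qed.

Lemma goodT v : good v (fun=> true).
Proof.
move=> p q r u3 sub; have := Hgen v v (box0 1) u3 sub; congr (H (cycle3 a _ p q r)).
by apply/funext => x; rewrite /piece (act0 aP) andbb andbT.
Qed.

Lemma goodC v U : loc_const U -> good v U -> good v (fun x => ~~ U x).
Proof.
have [H1 HM HV] := (group_closedE H).1 Hg.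
move=> Uc gU p q r u3 sub.
have aC : apart a (diffs [:: p; q; r]) (cell v) by apply: (apart_cell_sub (R := 3) (v := v)).
have := goodT v u3 sub; rewrite (_ : (fun x => _) = cell v); last first.
  by apply/funext => x; rewrite andbT.
rewrite (cycle3_split aP (cell_loc_const v) Uc u3 aC) => HC.
have := HM _ _ (HV _ (gU p q r u3 sub)) HC.
by rewrite mulKg.
Qed.

Lemma good_cell_translate v w e : e \in box 1 -> good v (fun x => lam (a e x) == w).
Proof. by move=> eB p q r u3 sub; exact: Hgen. Qed.

(** On the part of [U] moved by [e] into the cell of [w], cycles are known for
    the labels of the box around [e] by goodness of [U] in that cell, and cycles
    on a larger set are known for the labels of the box around [0]. *)
Lemma good_shift v U e : e \in box 1 -> loc_const U -> (forall w, good w U) ->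
  good v (fun x => U (a e x)).
Proof.
move=> eB Uc gU p q r u3 sub.
have Uec : loc_const (fun x => U (a e x)) by exact: loc_const_homeo.
have lec : loc_const (fun x => lam (a e x)) by exact: loc_const_homeo.
apply: (cycle3_partition aP Hg (k := fun x => lam (a e x))) => //.
- exact: cell_and_loc_const.
- by apply: (apart_cell_sub (R := 3) (v := v)) => // x /andP[].
move=> w; set P := fun x => _.
have PE x : P x = [&& cell v x, U (a e x) & lam (a e x) == w] by rewrite /P -andbA.
have Pc : loc_const P.
  apply: (loc_const_map2 andb); first exact: cell_and_loc_const.
  exact: (loc_const_map (fun u => u == w)).
(* The box of size [2] lies in the box of size [3] and in its translate by [e]. *)
pose L1 := [seq l + e | l <- box 3].
have box23 : {subset box 2 <= box (d := d) 3} by move=> k; exact: box_mono.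
suff c : cycles_in a H (L1 ++ box 3) P.
  by apply: c => // l /sub lB; rewrite mem_cat lB orbT.
have sL : {subset L1 ++ box 3 <= box (d := d) 4}.
  move=> l; rewrite mem_cat => /orP[/mapP[k kB ->]|]; last exact: box_mono.
  exact: (boxD kB eB).
apply: (cycles_in_union aP Hg (I := box 2) (W := piece v w e)) => //.
- by apply: cell_and_loc_const; exact: (loc_const_map (fun u => u == w)).
- by move=> x; rewrite PE => /and3P[lx _ lex]; apply/andP.
- by apply: (apart_cell_sub (R := 4) (v := v)) => // x /andP[].
- exact: box_uniq.
- exact: size_box2.
- move=> k kB; apply/mapP; exists (k - e); last by rewrite subrK.
  exact: (box_sub kB eB).
- apply: (cycles_in_translate aP).
  have -> : (fun x => P (a (- e) x)) =
      (fun x => cell w x && (U x && (lam (a (- e) x) == v))).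
    apply/funext => x; rewrite PE (actKN aP) /cell.
    by rewrite andbCA [_ && (lam x == w)]andbC andbCA.
  apply: goodI => //; last by apply: good_cell_translate; rewrite boxN.
  by apply: (loc_const_map (fun u => u == v)); exact: loc_const_homeo.
- by move=> p' q' r'; exact: Hgen.
Qed.

Lemma good_all U : loc_const U -> good_set U.
Proof.
apply: (separating_algebra (space_compact aP)).
- by move=> W [].
- move=> W [Wc gW]; split; first exact: (loc_const_map negb).
  by move=> v; exact: goodC.
- move=> W W' [Wc gW] [W'c gW']; split; first exact: (loc_const_map2 andb).
  by move=> v; exact: goodI.
- by split; [exact: loc_const_cst | exact: goodT].
move=> x y xy.
have [g gxy] : exists g, lam (a g x) != lam (a g y).
  apply: contrapT => same; move/eqP: xy; apply; apply: lam_expansive => g.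
  by apply/eqP; apply/negPn/negP => gxy; apply: same; exists g.
exists (fun z => lam (a g z) == lam (a g x)); last by rewrite eqxx eq_sym.
have shift_good h W : good_set W -> good_set (fun z => W (a h z)).
  move: h W; apply: box_ind => [|h e eB IH] W gW.
    by rewrite (_ : (fun z => _) = W) //; apply/funext => z; rewrite (act0 aP).
  rewrite (_ : (fun z => _) = (fun z => W (a h (a e z)))); last first.
    by apply/funext => z; rewrite (actD aP).
  have [W'c gW'] := IH W gW; split; first exact: (loc_const_homeo (a e) W'c).
  by move=> v; exact (@good_shift v _ e eB W'c gW').
apply: (shift_good g (fun z => lam z == lam (a g x))); split.
  exact: (loc_const_map (fun u => u == _)).
move=> v p q r u3 sub; have := Hgen v (lam (a g x)) (box0 1) u3 sub.
congr (H (cycle3 a _ p q r)).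
by apply/funext => z; rewrite /piece (act0 aP).
Qed.

Lemma cycles_in_box3 U : loc_const U -> apart a (box 6) U -> cycles_in a H (box 3) U.
Proof.
move=> Uc aU p q r u3 sub.
apply: (cycle3_partition aP Hg (k := lam)) => //.
  by apply: apart_sub aU => // l; exact: (diffs_box sub).
move=> v; have := (good_all Uc).2 v p q r u3 sub; congr (H (cycle3 a _ p q r)).
by apply/funext => x; rewrite andbC.
Qed.

(** The label is reached from the box by a chain of unit translations, and at
    each step the box and its translate have enough common labels; the set must
    be the more apart from its translates the longer the chain is. *)
Lemma cycles_in_cons g : exists R, forall U, loc_const U -> apart a (box R) U ->
  cycles_in a H (g :: box 3) U.
Proof.
move: g; apply: box_ind => [|g e eB [R HR]].
  exists 6%N => U Uc aU; apply: cycles_in_sub (cycles_in_box3 Uc aU).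
  by move=> l; rewrite inE => /predU1P[->|//]; exact: box0.
pose L1 := [seq l + e | l <- g :: box 3].
have [R2 sR2] := sub_some_box (diffs (L1 ++ box 3)).
exists (R + R2 + 6)%N => U Uc aU.
have aUR R' : (R' <= R + R2 + 6)%N -> apart a (box R') U.
  by move=> le; apply: apart_sub aU => // l; exact: box_mono.
suff c : cycles_in a H (L1 ++ box 3) U.
  apply: cycles_in_sub c => l; rewrite inE => /predU1P[->|lB].
    by rewrite mem_cat mem_head.
  by rewrite mem_cat lB orbT.
apply: (cycles_in_union aP Hg (I := box 2) (W := U)) => //.
- by apply: apart_sub (aUR R2 _) => //; lia.
- exact: box_uniq.
- exact: size_box2.
- move=> k kB; apply/mapP; exists (k - e); last by rewrite subrK.
  by rewrite inE (box_sub kB eB) orbT.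
- by move=> k; exact: box_mono.
- apply: (cycles_in_translate aP); apply: HR; first exact: loc_const_homeo.
  by apply: (apart_shift aP); apply: aUR; lia.
- by apply: cycles_in_box3 => //; apply: aUR; lia.
Qed.

Lemma cycle3_generated p q r : uniq [:: p; q; r] ->
  exists R, forall U, loc_const U -> apart a (box R) U -> H (cycle3 a U p q r).
Proof.
move=> u3; have [R1 H1] := cycles_in_cons p; have [R2 H2] := cycles_in_cons q.
have [R3 H3] := cycles_in_cons r.
pose L := ((p :: box 3) ++ (q :: box 3)) ++ (r :: box 3).
have [R4 sR4] := sub_some_box (diffs L).
exists (R1 + R2 + R3 + R4)%N => U Uc aU.
have aUR R' : (R' <= R1 + R2 + R3 + R4)%N -> apart a (box R') U.
  by move=> le; apply: apart_sub aU => // l; exact: box_mono.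
have aL : apart a (diffs L) U by apply: apart_sub (aUR R4 _) => //; lia.
have c : cycles_in a H L U.
  apply: (cycles_in_union aP Hg (I := box 3) (W := U)) => //.
  - exact: box_uniq.
  - exact: size_box2.
  - by move=> k kB; rewrite mem_cat inE kB orbT.
  - by move=> k kB; rewrite inE kB orbT.
  - apply: (cycles_in_union aP Hg (I := box 3) (W := U)) => //.
    + apply: (apart_translate _ _ aL) => // l lL.
      by rewrite mem_cat lL.
    + exact: box_uniq.
    + exact: size_box2.
    + by move=> k kB; rewrite inE kB orbT.
    + by move=> k kB; rewrite inE kB orbT.
    + by apply: H1 => //; apply: aUR; lia.
    + by apply: H2 => //; apply: aUR; lia.
  - by apply: H3 => //; apply: aUR; lia.
apply: c => // l; rewrite !inE => /or3P[] /eqP ->.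
- by rewrite !(mem_cat, inE) eqxx.
- by rewrite !(mem_cat, inE) eqxx ?orbT.
- by rewrite !(mem_cat, inE) eqxx ?orbT.
Qed.

Lemma order3_in_generated : generated (order3 a) `<=` H.
Proof.
apply: generated_sub => // f [Ff f3].
apply: (order3_generated aP Hg _ Ff f3) => g h /cycle3_generated[R HR].
by exists (box R).
Qed.

End Generated.

End Generators.

(** * Minimal faithful actions on the Cantor set *)

Lemma cover_compact_homeo (S T : topologicalType) (phi : homeo S T) :
  cover_compact [set: S] -> cover_compact [set: T].
Proof.
move=> cS I D f fo fcov; case: (cS I D (fun i => phi @^-1` f i)).
- by move=> i Di; apply: open_comp (fo i Di) => x _; exact: homeo_continuous.
- by move=> x _; have [i Di fi] := fcov (phi x) Logic.I; exists i.
move=> D' D'D cov; exists D' => // y _.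
have [i Di fi] := cov (homeo_inv phi y) Logic.I.
by exists i => //; move: fi; rewrite /= homeoVK.
Qed.

Lemma cantor_set_compact (C : topologicalType) : cantor_set C -> cover_compact [set: C].
Proof.
case=> phi; apply: (cover_compact_homeo phi).
by rewrite -compact_cover; exact: cantor_space_compact.
Qed.

Lemma cantor_set_separated (C : topologicalType) (x y : C) : cantor_set C -> x != y ->
  exists2 u : C -> bool, loc_const u & u x && ~~ u y.
Proof.
case=> phi xy; have [|U [Uclopen Ux Uy]] :=
    cantor_zero_dimensional (x := homeo_inv phi x) (y := homeo_inv phi y).
  by rewrite (can_eq (homeoVK phi)).
exists (fun z => `[< U (homeo_inv phi z) >]).
  apply: (loc_const_comp (u := fun z => `[< U z >])).
    exact: homeo_inv_continuous.
  exact: clopen_loc_const.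
by rewrite asboolT //= asboolF.
Qed.

(** An abelian group acting minimally and faithfully acts freely: an element
    fixing a point fixes its whole orbit, which is dense. *)
Lemma free_of_minimal_faithful (V : zmodType) (C : topologicalType)
    (a : V -> selfhomeo C) :
  cantor_set C -> is_action a -> minimal_action a -> faithful_action a ->
  free_cantor_action a.
Proof.
move=> hC ha hmin hfaith; split=> //.
- move=> g h x ghx; apply: hfaith; apply: homeo_ext => y.
  apply/eqP/negPn/negP => ghy.
  have [u uc ughy] := cantor_set_separated hC ghy.
  pose N z := u (a g z) && ~~ u (a h z).
  have Nc : loc_const N.
    apply: (loc_const_map2 (fun b c => b && ~~ c)).
      by apply: loc_const_comp uc; exact: homeo_continuous.
    by apply: loc_const_comp uc; exact: homeo_continuous.
  have [|z [/= Nz [k _ kz]]] := hmin x [set z | N z] _ (loc_const_open Nc).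
    by exists y.
  have comm m : a m (a k x) = a k (a m x).
    by rewrite -[LHS](congr1 (fun f : selfhomeo C => f x) (ha m k)) addrC ha.
  by move: Nz; rewrite /N -kz !comm ghx; case: (u _).
- exact: cantor_set_compact.
- by move=> x y; exact: cantor_set_separated.
Qed.

Section Coding.
Context {d : nat} {C : topologicalType} (a : 'rV[int]_d -> selfhomeo C).

Lemma subshift_coding : conjugate_to_subshift a ->
  exists (X : eqType) (ell : C -> X), loc_const ell /\
    forall x y, (forall g, ell (a g x) = ell (a g y)) -> x = y.
Proof.
case=> X [W [W_inv [_ [phi phiE]]]].
pose ell x : X := val (phi x) 0.
have ellE g x : ell (a (- g) x) = val (phi x) g.
  by rewrite /ell phiE /= /shift sub0r opprK.
exists X, ell; split; last first.
  move=> x y xy; apply: (can_inj (homeoK phi)); apply: val_inj; apply/funext => g.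
  by rewrite -!ellE.
move=> x.
have cont : {for x, continuous (fun z => (val (phi z) 0 : discrete_topology X))}.
  apply: (@continuous_comp C W (discrete_topology X) phi (fun w : W => val w 0)).
    exact: homeo_continuous.
  apply: (@continuous_comp W {ptws 'rV[int]_d -> discrete_topology X}
    (discrete_topology X) set_val (fun w => w 0)).
    exact: initial_continuous.
  exact: (@proj_continuous _ (fun=> discrete_topology X) 0).
exact: (cont [set s | s = ell x] _).
Qed.

(** Refining the coding by a finite clopen cover separates nearby points of the
    same orbit. *)
Lemma separated_coding (aP : free_cantor_action a) (s : seq 'rV[int]_d) :
  conjugate_to_subshift a ->
  exists (X : eqType) (lam : C -> X), [/\ loc_const lam,
    forall x g, g \in s -> g != 0 -> lam (a g x) != lam x &
    forall x y, (forall g, lam (a g x) = lam (a g y)) -> x = y].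
Proof.
case/subshift_coding => X [ell [ellc ellsep]].
have /choice[U PU] := apart_nbhd aP s.
have Uc z : loc_const (U z) by case: (PU z).
have [|c Pc] := finite_cover (space_compact aP) Uc; first by move=> x; case: (PU x).
exists (X * seq bool)%type, (fun x => (ell x, [seq U z x | z <- c])); split.
- by apply: (loc_const_map2 pair) => //; exact: loc_const_seq.
- move=> x g gs g0; apply/eqP => -[_ /eq_in_map E].
  have /hasP[z zc Uzx] := Pc x; have [_ _ aU] := PU z.
  by have := aU g gs g0 x Uzx; rewrite E // Uzx.
- by move=> x y E; apply: ellsep => g; have [] := E g.
Qed.

(** Two spare labels of the box turn the cycle into a commutator of two cycles
    that share one label. *)
Lemma cycle3_in_commutator (aP : free_cantor_action a) (p q r : 'rV[int]_d) (U : C -> bool) :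
  (0 < d)%N -> loc_const U -> apart a (box 6) U -> uniq [:: p; q; r] ->
  {subset [:: p; q; r] <= box 3} -> commutator_subgroup (full_group a) (cycle3 a U p q r).
Proof.
move=> d0 Uc aU u3 sub.
have [|u [s [uB sB [+ +]]]] := @two_more _ (box 3) [:: p; q; r] (box_uniq 3).
  by have := ltn_size_box 3 d0; rewrite /=; lia.
rewrite !inE !negb_or => /and3P[up uq ur] /and4P[su sp sq sr].
move: u3; rewrite /= !inE negb_or andbT => /andP[/andP[pq pr] qr].
have [pB qB rB] : [/\ p \in box 3, q \in box 3 & r \in box 3].
  by split; apply: sub; rewrite !inE eqxx ?orbT.
have UE : U = (fun x => U x && U x) by apply/funext => x; rewrite andbb.
have aL L : {subset L <= box 3} -> apart a (diffs L) U.
  by move=> sL; apply: apart_sub aU => // g; exact: (diffs_box sL).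
rewrite UE -(commutator_cycle3 aP (Q := U) (q' := u) (r' := s)) //.
- apply: sub_generated; exists (cycle3 a U p u q).
    apply: (cycle3_spec aP _ _ _).1 => //; last by apply: aL; exact: subset3.
    by rewrite /= !inE negb_or eq_sym up pq uq.
  exists (cycle3 a U p s r) => //.
  apply: (cycle3_spec aP _ _ _).1 => //; last by apply: aL; exact: subset3.
  by rewrite /= !inE negb_or eq_sym sp pr sr.
- rewrite /= !inE !negb_or (eq_sym p u) up pq (eq_sym p s) sp pr uq (eq_sym u s) su ur.
  by rewrite (eq_sym q s) sq qr sr.
- by apply: aL => l; rewrite !inE => /or4P[|||/orP[]] /eqP ->.
Qed.

End Coding.

Theorem theorem1 (d : nat) (hd : (1 <= d)%N)
    (C : topologicalType) (hC : cantor_set C)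
    (a : 'rV[int]_d -> selfhomeo C) (ha : is_action a)
    (hmin : minimal_action a) (hfaith : faithful_action a)
    (hshift : conjugate_to_subshift a) :
  finitely_generated (commutator_subgroup (full_group a)).
Proof.
have aP := free_of_minimal_faithful hC ha hmin hfaith.
have [X [lam [lamc lam_apart lam_exp]]] := separated_coding aP (box 8) hshift.
have [vals lam_vals] := loc_const_finite (space_compact aP) lamc.
pose cells := [seq (v, we) | v <- vals, we <- [seq (w, e) | w <- vals, e <- box (d := d) 1]].
pose labels := [seq (p, qr) | p <- box (d := d) 3,
  qr <- [seq (q, r) | q <- box (d := d) 3, r <- box (d := d) 3]].
pose params := [seq t <- [seq (c, l) | c <- cells, l <- labels] |
  uniq [:: t.2.1; t.2.2.1; t.2.2.2]].
pose gen t := cycle3 a (piece a lam t.1.1 t.1.2.1 t.1.2.2) t.2.1 t.2.2.1 t.2.2.2.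
have paramsP v w e p q r : v \in vals -> w \in vals -> e \in box 1 ->
    p \in box 3 -> q \in box 3 -> r \in box 3 -> uniq [:: p; q; r] ->
    ((v, (w, e)), (p, (q, r))) \in params.
  by move=> *; rewrite mem_filter; apply/andP; split=> //; do !apply: allpairs_f.
exists [set gen t | t in [set` params]]; first exact/finite_image/finite_seq.
rewrite eqEsubset; split; apply: generated_sub; try exact: generated_group.
  move=> _ [f Ff [g Fg <-]].
  apply: (order3_in_generated hd aP lamc lam_apart lam_exp (generated_group _)); last first.
    exact: (commutator_order3 aP hd Ff Fg).
  move=> v w e p q r eB u3 sub.
  have [G1 _ _] := (group_closedE _).1 (generated_group [set gen t | t in [set` params]]).
  (* Labels of cells that are not values of [lam] give the empty clopen set. *)
  have empty : (forall x, piece a lam v w e x = false) ->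
      generated [set gen t | t in [set` params]] (cycle3 a (piece a lam v w e) p q r).
    by move=> /funext ->; rewrite cycle3_empty.
  have [vv|/negP nv] := boolP (v \in vals); last first.
    by apply: empty => x; apply/andP => -[/eqP vx _]; apply: nv; rewrite -vx.
  have [wv|/negP nw] := boolP (w \in vals); last first.
    by apply: empty => x; apply/andP => -[_ /eqP wx]; apply: nw; rewrite -wx.
  apply: sub_generated; exists ((v, (w, e)), (p, (q, r))) => //=.
  by apply: paramsP => //; apply: sub; rewrite !inE eqxx ?orbT.
move=> _ [[[v [w e]] [p [q r]]] + <-].
rewrite /= mem_filter /= => /andP[u3 /allpairsP[[c l] [/= _ lL [_ pqr]]]].
move: lL; rewrite -pqr => /allpairsP[[p' qr'] [/= pB + [pE qrE]]].
rewrite -qrE => /allpairsP[[q' r'] [/= qB rB [qE rE]]]; rewrite -pE in pB.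
rewrite -qE in qB; rewrite -rE in rB.
apply: (cycle3_in_commutator aP) => //; last exact: subset3.
  apply: (loc_const_map2 andb); first exact: (loc_const_map (fun u => u == v)).
  by apply: (loc_const_map (fun u => u == w)); exact: loc_const_homeo.
apply: (apart_sub _ _ (apart_cell lam_apart (v := v))) => [g|x /andP[]//].
by apply: box_mono.
Qed.
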